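(* Let $\lambda:\mathbb{Z}_+\to[0,\infty)$ with $\lambda(0)>0$ and $\mu_1,\mu_2>0$. Assume $\mu_1\ge\mu_2$, and for each $n\ge0$ let $Z_n\sim\operatorname{geom}_n(\mu_1/\mu_2)$. Then $$\limsup_{n\to\infty}\mathrm{E}\,\lambda(Z_n)<\mu_2 \implies S(\lambda,\mu_1,\mu_2)\text{ is stable},$$ $$\liminf_{n\to\infty}\lambda(n)>\mu_2 \implies S(\lambda,\mu_1,\mu_2)\text{ is unstable (i.e. not stable)}.$$ Especially, if $\lim_{n\to\infty}\lambda(n)$ exists, then $$\lim_{n\to\infty}\lambda(n)<\mu_2 \implies S(\lambda,\mu_1,\mu_2)\text{ is stable},$$ $$\lim_{n\to\infty}\lambda(n)>\mu_2 \implies S(\lambda,\mu_1,\mu_2)\text{ is unstable}.$$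
   Context: $\mathbb{Z}_+=\{0,1,2,\dots\}$ and $e_1,e_2$ are the unit vectors of $\mathbb{Z}_+^2$. The system $S(\lambda,\mu_1,\mu_2)$ (for a nonnegative function $\lambda$ on $\mathbb{Z}_+$ and $\mu_1,\mu_2>0$) is the set of transition rates $q(x,y)$, $x\ne y$, $x,y\in\mathbb{Z}_+^2$, given by $q(x,x+e_1)=\lambda(x_2)$; $q(x,x-e_1+e_2)=\mu_1$ if $x_1\ge1$; $q(x,x-e_2)=\mu_2$ if $x_2\ge 1$; and $q(x,y)=0$ otherwise. Set $q(x)=\sum_{y\ne x}q(x,y)<\infty$ and $q(x,x)=-q(x)$. These rates define, by the minimal construction, a unique continuous-time Markov process $X=(X_1,X_2)$ on $\mathbb{Z}_+^2\cup\{\kappa\}$, where $\kappa$ is an extra state entered at the explosion time. The system is called stable if this Markov process is ergodic, that is, irreducible and positive recurrent (on $\mathbb{Z}_+^2$). For $z\ge0$, $Z_n\sim\operatorname{geom}_n(z)$ means that $Z_n$ takes values in $\{0,1,\dots,n\}$ with $\mathrm{P}(Z_n=j)=z^j/\sum_{i=0}^n z^i$. *)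

(* Defs.v *)
From HB Require Import structures.
From mathcomp Require Import all_boot all_order all_algebra.
From mathcomp Require Import all_classical all_reals all_analysis.
From mathcomp Require Import measurable_realfun.

Set Implicit Arguments.
Unset Strict Implicit.
Unset Printing Implicit Defensive.

Import Order.TTheory GRing.Theory Num.Theory.
Import numFieldNormedType.Exports.

Local Open Scope classical_set_scope.
Local Open Scope ring_scope.

(* Transition rates on a countable set are given by q : S -> S -> R; only the
   off-diagonal values q x y, x != y, are ever used, so the convention
   q x x = - exit_rate q x plays no role. *)

(* The total rate is assumed finite ([fine] sends +oo to 0); each row of
   [tandem_rate] below has at most three nonzero entries. *)
Definition exit_rate (R : realType) (S : countType) (q : S -> S -> R) (x : S) : R :=
  fine (\esum_(y in [set y | y != x]) (q x y)%:E)%E.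

Definition jump_prob (R : realType) (S : countType) (q : S -> S -> R)
    (x y : S) : R :=
  if exit_rate q x == 0 then (x == y)%:R
  else if x == y then 0 else q x y / exit_rate q x.

(* Under P x, Y is the jump chain and T the sequence of holding times of the
   minimal process with rates q started from x: Y is a Markov chain with
   transition matrix jump_prob q and Y_0 = x and, given Y, the T_i are
   independent and exponential with parameter exit_rate q (Y_i) (T_i = +oo if
   this rate is 0). *)
Definition jump_hold_law (R : realType) (S : countType) (q : S -> S -> R)
    (d : measure_display) (Omega : measurableType d)
    (P : S -> probability Omega R)
    (Y : nat -> Omega -> S) (T : nat -> Omega -> \bar R) : Prop :=
  [/\ forall n y, measurable (Y n @^-1` [set y]),
      forall n, measurable_fun setT (T n),
      forall n w, (0 < T n w)%E &
      forall (x : S) (n : nat) (y : nat -> S) (t : nat -> R),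
        (forall i, 0 <= t i) ->
        P x [set w | forall i, (i <= n)%N -> Y i w = y i /\ ((t i)%:E < T i w)%E]
        = ((y 0%N == x)%:R * \prod_(i < n) jump_prob q (y i) (y i.+1)
           * \prod_(i < n.+1) expR (- (exit_rate q (y i) * t i)))%:E].

(* (X_t)_{t >= 0} is the minimal process with rates q, P x being the law when
   started from x. The extra state entered at the explosion time
   \sum_k T_k is None; values of X at negative times are irrelevant. *)
Definition minimal_process (R : realType) (S : countType) (q : S -> S -> R)
    (d : measure_display) (Omega : measurableType d)
    (P : S -> probability Omega R) (X : R -> Omega -> option S) : Prop :=
  exists (Y : nat -> Omega -> S) (T : nat -> Omega -> \bar R),
    jump_hold_law q P Y T /\
    forall (t : R) (w : Omega), 0 <= t ->
      (forall n, (\sum_(k < n) T k w <= t%:E)%E ->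
                 (t%:E < \sum_(k < n.+1) T k w)%E -> X t w = Some (Y n w)) /\
      ((\sum_(0 <= k <oo) T k w <= t%:E)%E -> X t w = None).

Definition irreducible_process (R : realType) (S : countType)
    (d : measure_display) (Omega : measurableType d)
    (P : S -> probability Omega R) (X : R -> Omega -> option S) : Prop :=
  forall x y : S, exists2 t : R, 0 <= t & (0 < P x [set w | X t w = Some y])%E.

(* First time the path is at x after having left x; +oo if there is none. *)
Definition return_time (R : realType) (S : countType) (Omega : Type)
    (X : R -> Omega -> option S) (x : S) (w : Omega) : \bar R :=
  ereal_inf [set t%:E | t in
    [set t : R | X t w = Some x /\ exists2 s : R, 0 <= s <= t & X s w <> Some x]].

Definition positive_recurrent (R : realType) (S : countType)
    (d : measure_display) (Omega : measurableType d)
    (P : S -> probability Omega R) (X : R -> Omega -> option S) : Prop :=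
  forall x : S, (\int[P x]_w return_time X x w < +oo)%E.

Definition ergodic (R : realType) (S : countType)
    (d : measure_display) (Omega : measurableType d)
    (P : S -> probability Omega R) (X : R -> Omega -> option S) : Prop :=
  irreducible_process P X /\ positive_recurrent P X.

Definition tandem_rate (R : realType) (lambda : nat -> R) (mu1 mu2 : R)
    (x y : nat * nat) : R :=
  if y == (x.1.+1, x.2) then lambda x.2
  else if (1 <= x.1)%N && (y == (x.1.-1, x.2.+1)) then mu1
  else if (1 <= x.2)%N && (y == (x.1, x.2.-1)) then mu2
  else 0.

Definition geom_law (R : realType) (d : measure_display)
    (Omega : measurableType d) (P : probability Omega R)
    (n : nat) (z : R) (Z : Omega -> nat) : Prop :=
  forall j : nat, P (Z @^-1` [set j]) =
    (if (j <= n)%N then z ^+ j / \sum_(i < n.+1) z ^+ i else 0)%:E.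

(* Main.v *)
Require Import Defs.
From HB Require Import structures.
From mathcomp Require Import all_boot all_order all_algebra.
From mathcomp Require Import all_classical all_reals all_analysis.
From mathcomp Require Import measurable_realfun.
From mathcomp Require Import ring lra.

Set Implicit Arguments.
Unset Strict Implicit.
Unset Printing Implicit Defensive.

Import Order.TTheory GRing.Theory Num.Theory.
Import numFieldNormedType.Exports.

Local Open Scope classical_set_scope.
Local Open Scope ring_scope.

(** Write [A V] for the drift of a function [V] of the state, the rate of change
    of its mean along the process. In the states [x] with [x.1 > 0] the second
    queue evolves like a queue with arrival rate [mu1] and service rate [mu2]
    whose state, truncated at [n], has the law geom_n([mu1 / mu2]) in
    equilibrium. The potential [V x = x.1 + f x.2] turns this remark into a
    proof: with the deficits [H n = 1 - (f n - f n.-1)] and [H 0 = 1], its drift is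
    [lambda x.2 - mu2 + mu2 * H x.2 - mu1 * H x.2.+1] when [x.1 > 0], and the
    same without the last term when [x.1 = 0] ([linear_drift]).

    Stability. Define [H] by requiring a drift exactly [- eps] when [x.1 > 0].
    Solving the linear recurrence gives [H n.+1] the sign of
    [mu2 + \sum_(j <= n) (mu1 / mu2) ^ j * (lambda j + eps - mu2)]
    ([stable_deficitE]), which is negative for large [n] precisely because the
    geometric average of [lambda] stays below [mu2]; the hypothesis
    [mu2 <= mu1] makes the weights sum to infinity. Where [x.1 = 0] the drift is
    [- eps + mu1 * H x.2.+1], so it is at most [- eps] off the finite set of the
    states [(0, j)], [j < N], while [V] grows at least like [x.2]
    ([stable_potential]). On this finite set one adds a bounded potential whose
    drift is nonpositive off a given state [x] and as negative as desired on the
    set ([drain_on]); the sum has drift at most [- eps] everywhere but at [x].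
    Foster's argument then bounds the mean return time to [x]
    ([mean_return_time_fin]). Since [lambda] may be unbounded when
    [mu1 = mu2], explosion must be excluded: the potential is bounded in mean
    along the chain, the rates are bounded on its level sets, and a chain that
    never returned would therefore spend an infinite mean time before its
    return.

    Instability. When [lambda] is eventually at least [mu2 + 2 * eps], the
    deficits [H] are chosen at most 1/2, so that [V] increases in both coordinates,
    with drift at least [eps] off a finite set of states [(0, j)]. Then
    [1 / (c + V)] is superharmonic off this set for large [c], and truncating it
    gives a bounded subharmonic function vanishing at the origin
    ([unstable_potential]). Its existence forces a positive probability of never
    returning to the origin ([not_positive_recurrent_criterion]).

    Both criteria are proved for a general countable state space. They only use
    the taboo probabilities of the jump chain, the laws of the chain killed
    outside a set, and the one-step recursion [taboo_sumS] that they satisfy. *)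

(** * Sums over a countable type and integration *)

Section countable_sums.
Context {R : realType} {S : countType}.
Implicit Types f g : S -> \bar R.
Local Open Scope ereal_scope.

Lemma nneseries_pickle f : (forall z, 0 <= f z) ->
  \sum_(k <oo) oapp f 0 (pickle_inv k : option S) = \esum_(z in setT) f z.
Proof.
move=> f0.
have of0 k : 0 <= oapp f 0 (pickle_inv k : option S) by case: pickle_inv => /=.
rewrite nneseries_esumT//.
rewrite (esumID (range (@pickle S))) //.
rewrite [X in _ + X]esum1 ?adde0; last first.
  move=> k /= [_]; have := @pickle_invK S k.
  by case: (pickle_inv k) => //= z zk; case; exists z.
rewrite setTI (reindex_esum [set: S] _ (@pickle S)).
  by apply: eq_esum => z _; rewrite pickleK_inv.
by apply: inj_bij => a b _ _; exact: (pcan_inj pickleK).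
Qed.

Lemma ge0_esumZl (c : R) f : (0 <= c)%R -> (forall z, 0 <= f z) ->
  \esum_(z in setT) (c%:E * f z) = c%:E * \esum_(z in setT) f z.
Proof.
move=> c0 f0; rewrite -!nneseries_pickle//; last by move=> z; rewrite mule_ge0.
rewrite -nneseriesZl; last by move=> k _; case: pickle_inv => /=.
by apply: eq_eseriesr => k _; case: pickle_inv => //=; rewrite mule0.
Qed.

Lemma esum_exchange (a : S -> S -> \bar R) : (forall y z, 0 <= a y z) ->
  \esum_(y in setT) \esum_(z in setT) a y z =
  \esum_(z in setT) \esum_(y in setT) a y z.
Proof.
move=> a0; rewrite !esum_esum//.
rewrite (reindex_esum (setT `*`` (fun=> setT)) _ (fun x => (x.2, x.1)))//.
split=> //=; first by move=> [i1 i2] [j1 j2] /= _ _ [] -> ->.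
by move=> [i1 i2] _ /=; exists (i2, i1).
Qed.

Lemma le_esum1 f z : (forall z, 0 <= f z) -> f z <= \esum_(y in setT) f y.
Proof.
move=> f0; apply: esum_ge; exists [set z]; first by split.
by rewrite fsbig_set1.
Qed.

Context {d : measure_display} {Omega : measurableType d} (mu : {measure set Omega -> \bar R}).

Lemma ge0_integral_fibers (g : Omega -> S) (A : set Omega) (f : Omega -> \bar R) :
  (forall z, measurable (A `&` g @^-1` [set z])) ->
  measurable_fun A f -> (forall w, A w -> 0 <= f w) ->
  \int[mu]_(w in A) f w =
  \esum_(z in setT) \int[mu]_(w in A `&` g @^-1` [set z]) f w.
Proof.
move=> mg mf f0.
pose F k := if (pickle_inv k : option S) is Some z then A `&` g @^-1` [set z] else set0.
have AF : A = \bigcup_k F k.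
  apply/seteqP; split=> [w Aw|w [k _]].
    by exists (pickle (g w)) => //; rewrite /F pickleK_inv.
  by rewrite /F; case: pickle_inv => [z [] //|//].
rewrite {1}AF ge0_integral_bigcup -?AF//.
- rewrite -nneseries_pickle; last by move=> z; apply: integral_ge0 => w [/f0].
  apply: eq_eseriesr => k _; rewrite /F; case: pickle_inv => //=.
  by rewrite integral_set0.
- by move=> k; rewrite /F; case: pickle_inv.
apply/trivIsetP => i j _ _ ij; rewrite -subset0 => w [].
rewrite /F.
have := @pickle_invK S i; have := @pickle_invK S j.
case: (pickle_inv i) => //= z; case: (pickle_inv j) => //= y yj zi [_ gz] [_ gy].
by move: ij; rewrite -yj -zi -gz -gy eqxx.
Qed.

Lemma measure_fibers (g : Omega -> S) (A : set Omega) :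
  (forall z, measurable (A `&` g @^-1` [set z])) -> measurable A ->
  mu A = \esum_(z in setT) mu (A `&` g @^-1` [set z]).
Proof.
move=> mg mA; rewrite -[LHS]mul1e -integral_cst//.
rewrite (ge0_integral_fibers mg)//.
by apply: eq_esum => z _; rewrite integral_cst// mul1e.
Qed.

Lemma measurable_fibers (g : Omega -> S) (A : set Omega) :
  (forall z, measurable (A `&` g @^-1` [set z])) -> measurable A.
Proof.
move=> mg; rewrite (_ : A = \bigcup_(z in [set: S]) (A `&` g @^-1` [set z])).
  by apply: countable_bigcupT_measurable.
by apply/seteqP; split=> [w Aw|w [z _ []]//]; exists (g w).
Qed.

(** Monotonicity without measurability: the integral of a nonnegative function
    is a supremum over the simple functions below it. *)
Lemma le_integral_sup (f g : Omega -> \bar R) :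
  (forall w, 0 <= f w) -> (forall w, f w <= g w) ->
  \int[mu]_w f w <= \int[mu]_w g w.
Proof.
move=> f0 fg; have g0 w : 0 <= g w by exact: le_trans (fg w).
rewrite !ge0_integralTE//; apply: ereal_sup_le => _ [h hf <-].
by exists h => // w; exact: le_trans (hf w) (fg w).
Qed.

End countable_sums.
(** A discrete layer-cake bound: it turns the integral of a holding time into a
    series of tail probabilities. *)
Lemma le_sum_grid (R : realType) (a : \bar R) (h : R) : 0 < h -> (0 <= a)%E ->
  (a <= \sum_(j <oo) (if (j%:R * h)%:E < a then h%:E else 0))%E.
Proof.
move=> h0 a0; set s := (X in (a <= X)%E).
have h_ge0 j : (0 <= if (j%:R * h)%:E < a then h%:E else 0)%E.
  by case: ifP => // _; rewrite lee_fin ltW.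
have rs (r : R) : (r%:E <= a)%E -> (r%:E <= s)%E.
  move=> ra.
  have [N0 rN0] : exists N, r <= N%:R * h.
    exists (Num.bound `|r / h|).
    rewrite -ler_pdivrMr// ltW//.
    by rewrite (le_lt_trans (ler_norm _))// archi_boundP.
  case: (ex_minnP (ex_intro (fun N => r <= N%:R * h) N0 rN0)) => N rN Nmin.
  apply: (@le_trans _ _ (N%:R * h)%:E); first by rewrite lee_fin.
  apply: le_trans (nneseries_lim_ge N _); last by [].
  rewrite (eq_big_nat _ _ (F2 := fun=> h%:E)).
    by rewrite sumEFin big_const_nat subn0 iter_addr addr0 mulr_natl.
  move=> j /andP[_ jN]; rewrite ifT// (lt_le_trans _ ra)// lte_fin ltNge.
  by apply/negP => /Nmin; rewrite leqNgt jN.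
have [aoo|afin] := eqVneq a +oo%E.
  have -> : s = +oo%E by apply: eq_infty => r; apply: rs; rewrite aoo leey.
  exact: leey.
have {}afin : a \is a fin_num by rewrite ge0_fin_numE// lt_neqAle afin leey.
by have := rs (fine a); rewrite fineK//; exact.
Qed.


(** * Taboo probabilities of the jump chain *)

Section jump_chain.
Context {R : realType} {S : countType} (q : S -> S -> R).
Context {d : measure_display} {Omega : measurableType d}.
Variables (P : S -> probability Omega R) (Y : nat -> Omega -> S).
Variable T : nat -> Omega -> \bar R.
Hypothesis law : jump_hold_law q P Y T.
Hypothesis q_ge0 : forall x y, 0 <= q x y.
Hypothesis rate_gt0 : forall x, 0 < exit_rate q x.
Implicit Types (B : pred S) (x y z : S) (n : nat).

Let p := jump_prob q.

Lemma jump_prob_ge0 x y : 0 <= p x y.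
Proof.
rewrite /p /jump_prob gt_eqF//; case: ifP => // _.
by rewrite divr_ge0// ltW.
Qed.

Lemma measurable_state n z : measurable (Y n @^-1` [set z]).
Proof. by case: law. Qed.

Lemma measurable_hold n : measurable_fun setT (T n).
Proof. by case: law. Qed.

Lemma hold_gt0 n w : (0 < T n w)%E.
Proof. by case: law. Qed.

Lemma measurable_hold_gt n (t : R) : measurable [set w | (t%:E < T n w)%E].
Proof.
rewrite -[X in measurable X]setTI.
exact: (emeasurable_fun_o_infty measurableT (measurable_hold n)).
Qed.

Let past n (w : Omega) : seq S := mkseq (Y^~ w) n.+1.

Let past_eq n w (y : nat -> S) :
  past n w = mkseq y n.+1 <-> forall i, (i <= n)%N -> Y i w = y i.
Proof.
split=> [e i ni|e].
  have := congr1 (nth (y 0%N) ^~ i) e.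
  by rewrite !nth_mkseq.
apply: (@eq_from_nth _ (y 0%N)); rewrite !size_mkseq// => i ni.
by rewrite !nth_mkseq// e.
Qed.

Let past_prob x n (y : nat -> S) : R :=
  (y 0%N == x)%:R * \prod_(i < n) p (y i) (y i.+1).

Let past_tail x n (y : nat -> S) (t : R) : 0 <= t ->
  P x (past n @^-1` [set mkseq y n.+1] `&` [set w | (t%:E < T n w)%E]) =
  (past_prob x n y * expR (- (exit_rate q (y n) * t)))%:E.
Proof.
move=> t0; case: law => _ _ _ /(_ x n y (fun i => if i == n then t else 0)).
rewrite big_ord_recr/= eqxx [X in _ * (X * _)]big1 ?mul1r; last first.
  by move=> i _; rewrite ltn_eqF// mulr0 oppr0 expR0.
move=> <-; last by move=> i; case: ifP.
congr (P x _); apply/seteqP; split=> w /=.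
  move=> [/past_eq e tT] i ni; split; first exact: e.
  by case: eqP => [->//|_]; exact: hold_gt0.
move=> h; split; first by apply/past_eq => i /h[].
by have [_] := h n (leqnn n); rewrite eqxx.
Qed.

Let pastE x n (y : nat -> S) :
  P x (past n @^-1` [set mkseq y n.+1]) = (past_prob x n y)%:E.
Proof.
rewrite -[X in X%:E]mulr1 -expR0 -oppr0 -[X in - X](mulr0 (exit_rate q (y n))).
rewrite -past_tail//; congr (P x _); apply/esym/setIidl => w _ /=.
exact: hold_gt0.
Qed.

Let past_next x n (y : nat -> S) z :
  P x (past n @^-1` [set mkseq y n.+1] `&` Y n.+1 @^-1` [set z]) =
  (past_prob x n y * p (y n) z)%:E.
Proof.
pose y' i := if i == n.+1 then z else y i.
have y'E i : (i <= n)%N -> y' i = y i by move=> ni; rewrite /y' ltn_eqF.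
have y'z : y' n.+1 = z by rewrite /y' eqxx.
have -> : (past_prob x n y * p (y n) z)%R = past_prob x n.+1 y'.
  rewrite /past_prob big_ord_recr/= (y'E 0%N)// (y'E n)// y'z mulrA; congr (_ * _ * _).
  by apply: eq_bigr => i _; rewrite !y'E// ltnW.
rewrite -pastE; congr (P x _); apply/seteqP; split=> w /=.
  move=> [/past_eq e ez]; apply/past_eq => i; rewrite leq_eqVlt ltnS.
  by case/predU1P => [->|ni]; rewrite ?y'z ?ez ?e ?y'E.
move=> /past_eq e; split; last by rewrite /= e.
by apply/past_eq => i ni; rewrite e ?y'E// (leq_trans ni).
Qed.

Let measurable_past n s : measurable (past n @^-1` [set s]).
Proof.
have [ss|ss] := eqVneq (size s) n.+1; last first.
  rewrite (_ : _ @^-1` _ = set0)//; apply/seteqP; split=> // w /= ws.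
  by move: ss; rewrite -ws size_mkseq eqxx.
case: s ss => [//|s0 s] ss.
rewrite (_ : _ @^-1` _ = \bigcap_(i in `I_n.+1) (Y i @^-1` [set nth s0 (s0 :: s) i])).
  by apply: fin_bigcap_measurable => // i _; exact: measurable_state.
apply/seteqP; split=> w /=.
  by move=> <- i /= ni; rewrite nth_mkseq.
move=> h; apply: (@eq_from_nth _ s0); rewrite size_mkseq// => i ni.
by rewrite nth_mkseq// h.
Qed.

Let measurable_past_in n (A : set (seq S)) : measurable (past n @^-1` A).
Proof.
apply: (@measurable_fibers _ _ _ (past n)) => s.
have [As|As] := pselect (A s).
  rewrite (_ : _ `&` _ = past n @^-1` [set s]); first exact: measurable_past.
  by apply/seteqP; split=> [w []//|w /= ws]; split=> //=; rewrite ws.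
by rewrite (_ : _ `&` _ = set0)//; apply/seteqP; split=> // w [] /= + ws; rewrite ws.
Qed.

(** The Markov property: an event whose conditional probability given the whole
    past is a function of the present state alone keeps that conditional
    probability given only part of the information on the past.  *)
Let past_product x n (A : set (seq S)) z (C : set Omega) (c : R) :
  measurable C -> 0 <= c ->
  (forall y : nat -> S, y n = z -> P x (past n @^-1` [set mkseq y n.+1] `&` C) =
     (past_prob x n y * c)%:E) ->
  P x (past n @^-1` A `&` Y n @^-1` [set z] `&` C) =
  (c%:E * P x (past n @^-1` A `&` Y n @^-1` [set z]))%E.
Proof.
move=> mC c0 hC.
have mA : measurable (past n @^-1` A `&` Y n @^-1` [set z]).
  by apply: measurableI; [exact: measurable_past_in|exact: measurable_state].
rewrite (@measure_fibers _ _ _ _ _ (past n)); first last.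
- exact: measurableI.
- by move=> s; apply: measurableI; [exact: measurableI|exact: measurable_past].
rewrite (@measure_fibers _ _ _ _ (P x) (past n) (_ `&` Y n @^-1` _))//; last first.
  by move=> s; apply: measurableI => //; exact: measurable_past.
rewrite -ge0_esumZl//; apply: eq_esum => s _.
have [[w0 [[Aw0 w0z] w0s]]|h0] := pselect (exists w,
    (past n @^-1` A `&` Y n @^-1` [set z] `&` past n @^-1` [set s]) w).
  rewrite /= in w0z w0s.
  have AE : past n @^-1` A `&` Y n @^-1` [set z] `&` past n @^-1` [set s] =
      past n @^-1` [set s].
    apply/seteqP; split=> [w []//|w /= ws]; split=> //; split.
      by rewrite /= ws -w0s.
    rewrite /= -w0z; move: ws; rewrite -w0s => /past_eq; exact.
  have sE : s = mkseq (Y^~ w0) n.+1 by rewrite -w0s.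
  rewrite setIAC AE sE; apply: (etrans (hC _ w0z)).
  by rewrite mulrC EFinM; congr (_ * _)%E; rewrite -pastE.
have E1 : past n @^-1` A `&` Y n @^-1` [set z] `&` C `&` past n @^-1` [set s] = set0.
  by apply/seteqP; split=> // w [[[? ?] ?] ?]; apply: h0; exists w.
have E2 : past n @^-1` A `&` Y n @^-1` [set z] `&` past n @^-1` [set s] = set0.
  by apply/seteqP; split=> // w [[? ?] ?]; apply: h0; exists w.
by rewrite E1 E2 measure0 mule0.
Qed.

Definition stay B n : set Omega :=
  [set w | forall i, (0 < i <= n)%N -> B (Y i w)].

Let stayE B n z : stay B n =
  past n @^-1` [set s | forall i, (0 < i <= n)%N -> B (nth z s i)].
Proof.
by apply/seteqP; split=> w /= h i /[dup] /h + /andP[_ ni]; rewrite nth_mkseq.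
Qed.

Lemma measurable_stay B n : measurable (stay B n).
Proof.
rewrite (_ : stay B n = \bigcap_(i in [set i | (0 < i <= n)%N])
  [set w | B (Y i w)]); last by [].
apply: bigcap_measurableType => i _.
apply: (@measurable_fibers _ _ _ (Y i)) => z.
case Bz: (B z).
  rewrite (_ : _ `&` _ = Y i @^-1` [set z]); first exact: measurable_state.
  by apply/seteqP; split=> [w []//|w /= ws]; split=> //=; rewrite ws.
rewrite (_ : _ `&` _ = set0)//; apply/seteqP; split=> // w [] /= + ws.
by rewrite ws Bz.
Qed.

(** With [B] the complement of the starting point, this is the law after [n]
    jumps of the chain killed at its first return. *)
Definition taboo B x n z : \bar R := P x (stay B n `&` Y n @^-1` [set z]).

Lemma measurable_taboo B n z : measurable (stay B n `&` Y n @^-1` [set z]).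
Proof.
by apply: measurableI; [exact: measurable_stay|exact: measurable_state].
Qed.

Lemma taboo_ge0 B x n z : (0 <= taboo B x n z)%E.
Proof. exact: measure_ge0. Qed.

Lemma taboo0 B x z : taboo B x 0 z = (z == x)%:R%:E.
Proof.
rewrite /taboo (_ : stay B 0 = setT); last first.
  by apply/seteqP; split=> // w _ i; case: i.
have := pastE x 0 (fun=> z); rewrite /past_prob big_ord0 mulr1 => <-.
congr (P x _); rewrite setTI; apply/seteqP; split=> w /=.
  by move=> wz; apply/past_eq => i; rewrite leqn0 => /eqP ->.
by move=> /past_eq -> .
Qed.

Lemma taboo_hold B x n z (t : R) : 0 <= t ->
  P x (stay B n `&` Y n @^-1` [set z] `&` [set w | (t%:E < T n w)%E]) =
  ((expR (- (exit_rate q z * t)))%:E * taboo B x n z)%E.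
Proof.
move=> t0; rewrite /taboo (stayE B n z); apply: past_product.
- exact: measurable_hold_gt.
- exact: expR_ge0.
- by move=> y yz; rewrite past_tail// yz.
Qed.

Lemma taboo_next B x n z y :
  P x (stay B n `&` Y n @^-1` [set z] `&` Y n.+1 @^-1` [set y]) =
  ((p z y)%:E * taboo B x n z)%E.
Proof.
rewrite /taboo (stayE B n z); apply: past_product.
- exact: measurable_state.
- exact: jump_prob_ge0.
- by move=> f fz; rewrite past_next// fz.
Qed.

Lemma tabooS B x n y : taboo B x n.+1 y =
  if B y then (\esum_(z in setT) ((p z y)%:E * taboo B x n z))%E else 0%E.
Proof.
rewrite /taboo; case: ifP => By.
  rewrite (_ : stay B n.+1 `&` _ = stay B n `&` Y n.+1 @^-1` [set y]); last first.
    apply/seteqP; split=> w /= [h wy]; split=> // i.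
      by move=> /andP[i0 ni]; apply: h; rewrite i0 leqW.
    move=> /andP[i0]; rewrite leq_eqVlt ltnS => /predU1P[->|ni].
      by rewrite wy.
    by apply: h; rewrite i0.
  rewrite (@measure_fibers _ _ _ _ _ (Y n)); first last.
  - by apply: measurableI; [exact: measurable_stay|exact: measurable_state].
  - move=> z; rewrite setIAC; apply: measurableI; last exact: measurable_state.
    exact: measurable_taboo.
  by apply: eq_esum => z _; rewrite setIAC; exact: taboo_next.
rewrite (_ : _ `&` _ = set0) ?measure0//; apply/seteqP; split=> // w [/= h wy].
by have := h n.+1; rewrite wy By ltn0Sn leqnn => /(_ isT).
Qed.

Lemma taboo_fin_num B x n z : taboo B x n z \is a fin_num.
Proof. by apply: fin_num_measure; exact: measurable_taboo. Qed.

(** The last jump is transferred from the law to the test function: this is how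
    inequalities on one-step means act on the killed chain. *)
Lemma taboo_sumS B x n (g : S -> R) : (forall y, 0 <= g y) ->
  (\esum_(y in setT) (taboo B x n.+1 y * (g y)%:E))%E =
  (\esum_(z in setT) (taboo B x n z *
     \esum_(y in setT) (p z y * (if B y then g y else 0))%:E))%E.
Proof.
move=> g0; have p0 := jump_prob_ge0.
have h0 y : 0 <= (if B y then g y else 0) by case: ifP.
pose a y z := ((p z y * (if B y then g y else 0))%:E * taboo B x n z)%E.
have a0 y z : (0 <= a y z)%E.
  by rewrite mule_ge0 ?taboo_ge0// lee_fin mulr_ge0// p0.
transitivity (\esum_(y in setT) \esum_(z in setT) a y z)%E.
  apply: eq_esum => y _; rewrite tabooS /a; case: ifP => By.
    rewrite muleC -ge0_esumZl//.
      by apply: eq_esum => z _; rewrite muleA -EFinM mulrC.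
    by move=> z; rewrite mule_ge0 ?taboo_ge0// lee_fin p0.
  by rewrite mul0e esum1// => z _; rewrite mulr0 mul0e.
rewrite esum_exchange//; apply: eq_esum => z _.
rewrite -[taboo B x n z]fineK ?taboo_fin_num// -ge0_esumZl.
- by apply: eq_esum => y _; rewrite /a muleC fineK// taboo_fin_num.
- by rewrite fine_ge0// taboo_ge0.
- by move=> y; rewrite lee_fin mulr_ge0// p0.
Qed.

Lemma taboo_step B x n z y : (0 < taboo B x n z)%E -> 0 < p z y -> B y ->
  (0 < taboo B x n.+1 y)%E.
Proof.
move=> z0 zy By; rewrite tabooS By.
apply: lt_le_trans (le_esum1 z _); first by rewrite mule_gt0.
by move=> u; rewrite mule_ge0 ?taboo_ge0// lee_fin jump_prob_ge0.
Qed.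

Lemma taboo_path B x n z s : (0 < taboo B x n z)%E ->
  path (fun a b => 0 < p a b) z s -> all B s ->
  (0 < taboo B x (size s + n) (last z s))%E.
Proof.
elim: s n z => [//|y s IH] n z z0 /= /andP[zy ys] /andP[By Bs].
by rewrite addSnnS; apply: IH => //; exact: taboo_step zy By.
Qed.

Lemma prob_stay B x n :
  P x (stay B n) = (\esum_(z in setT) taboo B x n z)%E.
Proof.
apply: measure_fibers; first exact: measurable_taboo.
exact: measurable_stay.
Qed.

End jump_chain.

(** * From the jump chain to the process *)

Section minimal_process_paths.
Context {R : realType} {S : countType} (q : S -> S -> R).
Context {d : measure_display} {Omega : measurableType d}.
Variables (P : S -> probability Omega R) (Y : nat -> Omega -> S).
Variable T : nat -> Omega -> \bar R.
Hypothesis law : jump_hold_law q P Y T.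
Hypothesis q_ge0 : forall x y, 0 <= q x y.
Hypothesis rate_gt0 : forall x, 0 < exit_rate q x.
Variable X : R -> Omega -> option S.
Hypothesis XE : forall (t : R) (w : Omega), 0 <= t ->
  (forall n, (\sum_(k < n) T k w <= t%:E)%E ->
             (t%:E < \sum_(k < n.+1) T k w)%E -> X t w = Some (Y n w)) /\
  ((\sum_(0 <= k <oo) T k w <= t%:E)%E -> X t w = None).
Implicit Types (B : pred S) (x y z : S) (n : nat) (w : Omega).

Let T_ge0 n w : (0 <= T n w)%E.
Proof. exact/ltW/(hold_gt0 law). Qed.

Definition jump_time n w : \bar R := (\sum_(k < n) T k w)%E.

Lemma jump_time_ge0 n w : (0 <= jump_time n w)%E.
Proof. by apply: sume_ge0 => i _; exact: T_ge0. Qed.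

Lemma jump_timeS n w : jump_time n.+1 w = (jump_time n w + T n w)%E.
Proof. by rewrite /jump_time big_ord_recr. Qed.

Lemma jump_time_le m n w : (m <= n)%N -> (jump_time m w <= jump_time n w)%E.
Proof.
move=> /subnK <-; elim: (n - m)%N => // k IH.
by rewrite addSn jump_timeS (le_trans IH)// leeDl// T_ge0.
Qed.

Lemma jump_time_lt n w : jump_time n w \is a fin_num ->
  (jump_time n w < jump_time n.+1 w)%E.
Proof. by move=> fS; rewrite jump_timeS lteDl// (hold_gt0 law). Qed.

Lemma measurable_jump_time n : measurable_fun setT (jump_time n).
Proof. by apply: emeasurable_sum => i; exact: (measurable_hold law). Qed.

Lemma state_between t w n : 0 <= t -> (jump_time n w <= t%:E)%E ->
  (t%:E < jump_time n.+1 w)%E -> X t w = Some (Y n w).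
Proof. by move=> /(XE w)[h _]; exact: h. Qed.

Lemma state_at_jump w n : jump_time n w \is a fin_num ->
  X (fine (jump_time n w)) w = Some (Y n w).
Proof.
move=> fS; apply: state_between; rewrite ?fineK//; last exact: jump_time_lt.
by rewrite fine_ge0// jump_time_ge0.
Qed.

(** At a time when the process is in a state of [S] the explosion has not
    happened, so this time lies between two consecutive jumps. *)
Lemma process_state t w z : 0 <= t -> X t w = Some z ->
  exists n, [/\ Y n w = z, (jump_time n w <= t%:E)%E &
                (t%:E < jump_time n.+1 w)%E].
Proof.
move=> t0 Xz; have [_ Xnone] := XE w t0.
have [N tN] : exists N, (t%:E < jump_time N w)%E.
  apply: contrapT => /forallNP h.
  have : X t w = None; last by rewrite Xz.
  apply: Xnone; apply: lime_le.
    by apply: is_cvg_nneseries => k _ _; exact: T_ge0.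
  apply: nearW => n; rewrite big_mkord leNgt; apply/negP; exact: h.
have := ex_minnP (ex_intro (fun n => t%:E < jump_time n w)%E N tN).
case=> -[|n] tn nmin.
  by move: tn; rewrite /jump_time big_ord0 lte_fin ltNge t0.
have nt : (jump_time n w <= t%:E)%E.
  by rewrite leNgt; apply/negP => /nmin; rewrite ltnn.
exists n; split=> //.
by move: Xz; rewrite (state_between t0 nt tn) => -[].
Qed.

Lemma measurable_process t z : 0 <= t -> measurable [set w | X t w = Some z].
Proof.
move=> t0; rewrite (_ : [set w | _] = \bigcup_n (Y n @^-1` [set z] `&`
   ([set w | (jump_time n w <= t%:E)%E] `&`
    [set w | (t%:E < jump_time n.+1 w)%E]))).
  apply: bigcupT_measurable => n; apply: measurableI.
    exact: (measurable_state law).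
  have mS m := @measurable_jump_time m.
  apply: measurableI; rewrite -[X in measurable X]setTI.
    exact: (emeasurable_fun_infty_c measurableT (mS n)).
  exact: (emeasurable_fun_o_infty measurableT (mS n.+1)).
apply/seteqP; split=> [w /= /(process_state t0)[n [? ? ?]]|w [n _ [/= <- [? ?]]]].
  by exists n.
exact: state_between.
Qed.

(** The tail of [T n] given the state [z] is [expR (- q z * t)], which tends to
    zero. *)
Lemma hold_infty_null n x : P x [set w | T n w = +oo%E] = 0%E.
Proof.
have mT : measurable [set w | T n w = +oo%E].
  rewrite -[X in measurable X]setTI.
  exact: (measurable_hold law n measurableT (emeasurable_set1 +oo%E)).
have mTn z : measurable ([set w | T n w = +oo%E] `&` Y n @^-1` [set z]).
  by apply: measurableI => //; exact: (measurable_state law).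
rewrite (@measure_fibers _ _ _ _ _ (Y n))// esum1// => z _.
set A := _ `&` _.
have Afin : P x A \is a fin_num by apply: fin_num_measure; exact: mTn.
have A0 : 0 <= fine (P x A) by rewrite fine_ge0// measure_ge0.
have Ale t : 0 <= t -> fine (P x A) <= expR (- (exit_rate q z * t)).
  move=> t0; rewrite -lee_fin fineK//.
  have : (P x A <= P x (stay Y predT n `&` Y n @^-1` [set z] `&`
                        [set w | (t%:E < T n w)%E]))%E.
    apply: le_measure; rewrite ?inE.
    - exact: mTn.
    - apply: measurableI; first exact: (measurable_taboo law).
      exact: (measurable_hold_gt law).
    - by move=> w [/= Too Yz]; split=> /=; [split|rewrite Too ltry].
  rewrite (taboo_hold law)// => /le_trans; apply.
  rewrite -[leRHS]mule1 lee_wpmul2l ?lee_fin ?expR_ge0//.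
  by apply: probability_le1; exact: (measurable_taboo law).
rewrite -[LHS]fineK//; apply/eqP; rewrite eqe eq_le A0 andbT leNgt.
apply/negP => Agt0.
pose t := (fine (P x A))^-1 / exit_rate q z.
have tE : exit_rate q z * t = (fine (P x A))^-1.
  by rewrite /t mulrCA divff ?mulr1// gt_eqF.
have := Ale t (divr_ge0 (ltW (etrans (invr_gt0 _) Agt0)) (ltW (rate_gt0 z))).
rewrite tE expRN leNgt => /negP; apply.
rewrite invf_plt ?posrE ?expR_gt0//.
by rewrite (lt_le_trans _ (expR_ge1Dx _))// ltrDr.
Qed.

(** A state visited by the jump chain with positive probability is occupied
    during a nonempty time interval, which contains a rational number. *)
Lemma irreducible_criterion :
  (forall x y, exists n, (0 < taboo P Y predT x n y)%E) ->
  irreducible_process P X.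
Proof.
move=> reach x y; have [n] := reach x y; rewrite /taboo; set A := _ `&` _ => A0.
apply: contrapT => hX.
have X0 t : 0 <= t -> P x [set w | X t w = Some y] = 0%E.
  move=> t0; apply/eqP; rewrite eq_le measure_ge0 andbT leNgt; apply/negP => X0.
  by apply: hX; exists t.
have Anull : (P x).-negligible A.
  (* The union runs over the rationals, encoded as natural numbers. *)
  pose F k : set Omega := if (unpickle k : option rat) is Some r then
    if 0 <= ratr r :> R then [set w | X (ratr r) w = Some y] else set0 else set0.
  pose G k := F k `|` [set w | T k w = +oo%E].
  have : (P x).-negligible (\bigcup_k G k); last apply: negligibleS.
    apply: negligible_bigcup => k; apply: negligibleU.
      rewrite /F; case: unpickle => [r|]; last exact: negligible_set0.
      case: ifPn => r0; last exact: negligible_set0.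
      by apply/negligibleP; [exact: measurable_process|exact: X0].
    apply/negligibleP; last exact: hold_infty_null.
    rewrite -[X in measurable X]setTI.
    exact: (measurable_hold law k measurableT (emeasurable_set1 +oo%E)).
  move=> w [_ Yn].
  have [[k Tk]|Tfin] := pselect (exists k, T k w = +oo%E).
    by exists k => //; right.
  have Sfin k : jump_time k w \is a fin_num.
    elim: k => [|k IH]; first by rewrite /jump_time big_ord0.
    rewrite jump_timeS fin_numD IH/= ge0_fin_numE// lt_neqAle leey andbT.
    by apply/eqP => Tk; apply: Tfin; exists k.
  have : fine (jump_time n w) < fine (jump_time n.+1 w).
    by rewrite fine_lt// jump_time_lt.
  move=> /rat_in_itvoo[r]; rewrite in_itv/= => /andP[nr rn].
  have r0 : 0 <= ratr r :> R.
    by rewrite (le_trans _ (ltW nr))// fine_ge0// jump_time_ge0.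
  exists (pickle r) => //; left; rewrite /F pickleK r0/= -Yn.
  apply: state_between => //.
    by rewrite -[leLHS]fineK// lee_fin ltW.
  by rewrite -[ltRHS]fineK// lte_fin.
move: A0; rewrite (negligibleP _ _).1// ?ltxx//.
exact: (measurable_taboo law).
Qed.

Lemma return_time_ge0 x w : (0 <= return_time X x w)%E.
Proof.
apply/ereal_infP => u [t [Xt [s /andP[s0 st] Xs]] <-].
by rewrite lee_fin (le_trans s0).
Qed.

Let never x : set Omega := \bigcap_n stay Y (predC1 x) n.

Let measurable_never x : measurable (never x).
Proof. by apply: bigcapT_measurable => n; exact: (measurable_stay law). Qed.

(** A path that never jumps back to [x] is at [x] only during its first holding
    time, before leaving it. *)
Lemma return_time_never x w : never x w -> return_time X x w = +oo%E.
Proof.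
move=> nw; rewrite /return_time (_ : [set _ | _ in _] = set0) ?ereal_inf0//.
apply/seteqP; split=> // u [t [Xt [s /andP[s0 st] Xs]] ut].
have [n [Yn _ tn]] := process_state (le_trans s0 st) Xt.
case: n Yn tn => [|n] Yn tn.
  apply: Xs; rewrite -Yn; apply: state_between => //.
    by rewrite /jump_time big_ord0.
  by rewrite (le_lt_trans _ tn).
by have := nw n.+1 I n.+1; rewrite ltn0Sn leqnn Yn/= eqxx => /(_ isT).
Qed.

(** A chain that escapes has infinite mean return time: bounded functions [v]
    with [v <= p v] that vanish at [x] bound the probability of never
    returning from below. *)
Lemma not_positive_recurrent_criterion x (v : S -> R) m y :
  (forall z, 0 <= v z <= 1) -> v x = 0 -> 0 < v y ->
  (0 < taboo P Y (predC1 x) x m y)%E ->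
  (forall z, (v z)%:E <= \esum_(y in setT) (jump_prob q z y * v y)%:E)%E ->
  ~ positive_recurrent P X.
Proof.
move=> v01 vx vy ym vP.
have v0 z : 0 <= v z by case/andP: (v01 z).
pose B := predC1 x.
pose M n := (\esum_(z in setT) (taboo P Y B x n z * (v z)%:E))%E.
have t0 n z : (0 <= taboo P Y B x n z)%E by exact: taboo_ge0.
have MS n : (M n <= M n.+1)%E.
  rewrite /M (taboo_sumS law q_ge0 rate_gt0)//.
  apply: le_esum => z _; rewrite lee_wpmul2l//.
  rewrite (le_trans (vP z))//; apply: le_esum => u _.
  by rewrite /B/=; have [->|//] := eqVneq u x; rewrite vx mulr0.
have Mm n : (M m <= M (n + m)%N)%E.
  by elim: n => [//|n IH]; rewrite (le_trans IH)// addSn MS.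
have Mstay n : (M n <= P x (stay Y B n))%E.
  rewrite (prob_stay law); apply: le_esum => z _.
  by rewrite -[leRHS]mule1 lee_wpmul2l// lee_fin; case/andP: (v01 z).
have M0 : (0 < M m)%E.
  apply: lt_le_trans (le_esum1 y _); last first.
    by move=> z; rewrite mule_ge0// lee_fin.
  by rewrite mule_gt0// lte_fin.
have N0 : (0 < P x (never x))%E.
  apply: (lt_le_trans M0).
  have cv : P x (stay Y B n) @[n --> \oo] --> P x (never x).
    apply: nonincreasing_cvg_mu => //.
    - by rewrite (le_lt_trans (probability_le1 _ _))// ?ltry//; exact: (measurable_stay law).
    - by move=> n; exact: (measurable_stay law).
    - exact: measurable_never.
    - move=> i j ij; apply/subsetPset => w h k /andP[k0 ki].
      by apply: h; rewrite k0 (leq_trans ki).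
  rewrite -(cvg_lim _ cv)//; apply: lime_ge.
    by apply/cvg_ex; eexists; exact: cv.
  exists m => // n /= mn; apply: le_trans (Mstay n).
  by rewrite -(subnK mn) Mm.
move=> /(_ x); rewrite ltNge => /negP; apply.
rewrite (_ : +oo%E = \int[P x]_w ((cst +oo%E) \_ (never x)) w)%E.
  apply: le_integral_sup => w.
    by apply: erestrict_ge0 => u _; exact: leey.
  rewrite patchE; case: ifPn => [|_]; last exact: return_time_ge0.
  by rewrite inE => /return_time_never ->.
by rewrite -integral_mkcond integral_cst// gt0_mulye.
Qed.

(** Along the grid of mesh [h], the mean holding time, the exponential tails
    decrease at least like the powers of 1/2; their sum bounds the mean holding
    time up to a factor 2. *)
Lemma hold_integral B x n z :
  (\int[P x]_(w in stay Y B n `&` Y n @^-1` [set z]) T n w <=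
   2%:E * (taboo P Y B x n z * (exit_rate q z)^-1%:E))%E.
Proof.
set A := _ `&` _; have mA : measurable A by exact: (measurable_taboo law).
set h := (exit_rate q z)^-1; have h0 : 0 < h by rewrite invr_gt0.
pose E j := [set w | ((j%:R * h)%:E < T n w)%E].
have mE j : measurable (E j) by exact: (measurable_hold_gt law).
have fE j w : (if (j%:R * h)%:E < T n w then h%:E else 0)%E =
    (h%:E * (\1_(E j) w)%:E)%E.
  rewrite indicE; case: ifPn => jw.
    by rewrite mem_set ?mule1.
  by rewrite memNset ?mule0//; exact/negP.
have mf j : measurable_fun A (fun w => h%:E * (\1_(E j) w)%:E)%E.
  apply: measurable_funeM; apply/measurable_EFinP.
  by apply: measurable_funTS; exact: measurable_indic.
have f0 j w : (0 <= h%:E * (\1_(E j) w)%:E)%E by rewrite -EFinM lee_fin mulr_ge0// ltW.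
apply: (@le_trans _ _ (\int[P x]_(w in A) \sum_(j <oo) h%:E * (\1_(E j) w)%:E)%E).
  apply: ge0_le_integral => //.
  - by apply: measurable_funTS; exact: (measurable_hold law).
  - by apply: ge0_emeasurable_sum => j; [move=> w _ _; exact: f0|move=> _; exact: mf].
  - move=> w _; rewrite (le_trans (le_sum_grid h0 (T_ge0 n w)))//.
    by apply: lee_nneseries => j _; rewrite ?fE.
rewrite integral_nneseries//.
have IE j : (\int[P x]_(w in A) (h%:E * (\1_(E j) w)%:E) =
    (h * expR (- j%:R))%:E * taboo P Y B x n z)%E.
  rewrite ge0_integralZl//; last 2 first.
  - apply/measurable_EFinP.
    by apply: measurable_funTS; exact: measurable_indic.
  - by rewrite lee_fin ltW.
  rewrite integral_indic// setIC.
  transitivity (h%:E * ((expR (- (exit_rate q z * (j%:R * h))))%:E *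
                        taboo P Y B x n z))%E.
    by congr (_ * _)%E; apply: (taboo_hold law); rewrite mulr_ge0// ltW.
  rewrite muleA -EFinM; congr ((h * expR (- _))%:E * _)%E.
  by rewrite /h mulrCA divff ?mulr1// gt_eqF.
have t0 := taboo_ge0 P Y B x n z.
have tfin := taboo_fin_num law B x n z.
pose c := h * fine (taboo P Y B x n z).
have c0 : 0 <= c by rewrite mulr_ge0 ?fine_ge0// ltW.
apply: (@le_trans _ _ (\sum_(j <oo) (2 * c / (2 ^ j.+1)%:R)%:E)%E).
  apply: lee_nneseries => [j _|j _]; first by rewrite integral_ge0.
  rewrite IE -[taboo _ _ _ _ _ _]fineK// -EFinM.
  rewrite lee_fin (_ : 2 * c / _ =
    h * (2 / (2 ^ j.+1)%:R) * fine (taboo P Y B x n z)); last by rewrite /c; ring.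
  rewrite ler_wpM2r ?fine_ge0// ler_wpM2l//; first exact: ltW.
  rewrite expnS natrM invfM mulrA divff// mul1r natrX -exprVn.
  rewrite -mulrN1 expRM_natl expRN lerXn2r ?nnegrE ?invr_ge0 ?expR_ge0//.
  by rewrite lef_pV2 ?posrE ?expR_gt0// (le_trans _ (expR_ge1Dx 1)).
apply: (le_trans (epsilon_trick0 xpredT _)); first by rewrite mulr_ge0.
by rewrite /c mulrC -[in leRHS](fineK tfin) -!EFinM lee_fin mulrC [h * _]mulrC.
Qed.

(** * Foster's criterion *)

Section drift.
Variables (x : S) (W : S -> R).
Hypothesis W_ge0 : forall z, 0 <= W z.
Hypothesis W_drift : forall z, z != x ->
  (\esum_(y in setT) (jump_prob q z y * W y)%:E + (exit_rate q z)^-1%:E <=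
   (W z)%:E)%E.
Hypothesis W_start : (\esum_(y in setT) (jump_prob q x y * W y)%:E < +oo)%E.
(* The rates may be unbounded, but not where [W] is bounded. *)
Hypothesis W_level : forall M, exists K, forall z, W z <= M -> exit_rate q z <= K.

Let B := predC1 x.
Let tab n z := taboo P Y B x n z.
Let mean_after n (g : S -> R) := (\esum_(z in setT) (tab n z * (g z)%:E))%E.
Let ihold z := (exit_rate q z)^-1.

Let ihold_ge0 z : 0 <= ihold z. Proof. by rewrite invr_ge0 ltW. Qed.

Let tab_ge0 n z : (0 <= tab n z)%E. Proof. exact: taboo_ge0. Qed.

Let mean_after_ge0 n (g : S -> R) : (forall z, 0 <= g z) -> (0 <= mean_after n g)%E.
Proof. by move=> g0; apply: esum_ge0 => z _; rewrite mule_ge0// lee_fin. Qed.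

Let taboo_start_sum (g : S -> \bar R) : (0 <= g x)%E ->
  (\esum_(z in setT) (tab 0 z * g z) = g x)%E.
Proof.
move=> gx0; rewrite (esumID [set x]); last first.
  move=> z _; rewrite /tab (taboo0 law)//; have [->|_] := eqVneq z x.
    by rewrite mul1e.
  by rewrite mul0e.
rewrite [X in (_ + X)%E]esum1 ?adde0; last first.
  by move=> z [_ /= /eqP zx]; rewrite /tab (taboo0 law)// (negbTE zx) mul0e.
rewrite setTI esum_set1 /tab (taboo0 law)// eqxx mul1e//.
Qed.

Let mean_step_fin : (mean_after 1 W < +oo)%E.
Proof.
rewrite /mean_after /tab (taboo_sumS law q_ge0 rate_gt0)//.
have p0 z y : 0 <= jump_prob q z y by exact: jump_prob_ge0.
have h0 z : (0 <= \esum_(y in setT) (jump_prob q z y * (if B y then W y else 0))%:E)%E.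
  by apply: esum_ge0 => y _; rewrite lee_fin mulr_ge0//; case: ifP.
rewrite taboo_start_sum//; apply: le_lt_trans W_start; apply: le_esum => y _.
by rewrite lee_fin ler_wpM2l//; case: ifP.
Qed.

Let mean_drift n : (0 < n)%N ->
  (mean_after n.+1 W + mean_after n ihold <= mean_after n W)%E.
Proof.
move=> n0; rewrite {1}/mean_after /tab (taboo_sumS law q_ge0 rate_gt0)//.
have p0 z y : 0 <= jump_prob q z y by exact: jump_prob_ge0.
have h0 z : (0 <= \esum_(y in setT) (jump_prob q z y * (if B y then W y else 0))%:E)%E.
  by apply: esum_ge0 => y _; rewrite lee_fin mulr_ge0//; case: ifP.
rewrite /mean_after -esumD; last 2 first.
- by move=> z _; rewrite mule_ge0// taboo_ge0.
- by move=> z _; rewrite mule_ge0// lee_fin.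
apply: le_esum => z _.
have [zx|zx] := eqVneq z x.
  case: n n0 => // n _.
  by rewrite /tab (tabooS law q_ge0 rate_gt0) /B/= zx eqxx !mul0e adde0.
rewrite -ge0_muleDr ?lee_fin// lee_wpmul2l//.
apply: le_trans (W_drift zx); rewrite leeD2r// le_esum// => y _.
by rewrite lee_fin ler_wpM2l//; case: ifP.
Qed.

(** The means of [W] telescope, so that the mean holding times before the return
    have a sum bounded by the mean of [W] after the first jump. *)
Let mean_bound N :
  (mean_after N.+1 W + \sum_(1 <= n < N.+1) mean_after n ihold <=
   mean_after 1 W)%E.
Proof.
elim: N => [|N IH]; first by rewrite big_geq// adde0.
rewrite big_nat_recr//= [X in (_ + X)%E]addeC addeA.
by apply: le_trans IH; rewrite leeD2r// mean_drift.
Qed.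

Let w := fine (mean_after 1 W).

Let wE : mean_after 1 W = w%:E.
Proof. by rewrite /w fineK// ge0_fin_numE// mean_after_ge0. Qed.

Let w_ge0 : 0 <= w. Proof. by rewrite fine_ge0// mean_after_ge0. Qed.

Let sum_ihold_le N : (\sum_(1 <= n < N.+1) mean_after n ihold <= w%:E)%E.
Proof.
rewrite -wE; apply: le_trans (mean_bound N).
by rewrite leeDr// mean_after_ge0.
Qed.

Let mean_W_le n : (mean_after n.+1 W <= w%:E)%E.
Proof.
rewrite -wE; apply: le_trans (mean_bound n).
by rewrite leeDl// sume_ge0// => k _; exact: mean_after_ge0.
Qed.

(** Markov's inequality outside the level set [W <= M], where rates may be
    large, and comparison with the mean holding time inside. *)
Let stay_le M K n : 0 < M -> 0 <= K -> (forall z, W z <= M -> exit_rate q z <= K) ->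
  (P x (stay Y B n) <= M^-1%:E * mean_after n W + K%:E * mean_after n ihold)%E.
Proof.
move=> M0 K0 hK; rewrite (prob_stay law) /mean_after.
rewrite -!ge0_esumZl ?invr_ge0 ?(ltW M0)//; last 2 first.
- by move=> z; rewrite mule_ge0// lee_fin.
- by move=> z; rewrite mule_ge0// lee_fin.
rewrite -esumD; last 2 first.
- by move=> z _; rewrite !mule_ge0// lee_fin ?invr_ge0 ?(ltW M0).
- by move=> z _; rewrite !mule_ge0// lee_fin.
apply: le_esum => z _; rewrite ![(_%:E * (_ * _))%E]muleCA -ge0_muleDr//; last 2 first.
- by rewrite -EFinM lee_fin mulr_ge0// invr_ge0 ltW.
- by rewrite -EFinM lee_fin mulr_ge0.
rewrite -[leLHS]mule1 lee_wpmul2l// -!EFinM -EFinD lee_fin.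
have [WM|WM] := leP (W z) M.
  have rK : 1 <= K * ihold z by rewrite ler_pdivlMr// mul1r hK.
  by rewrite (le_trans rK)// lerDr mulr_ge0// invr_ge0 ltW.
have : 1 <= M^-1 * W z by rewrite mulrC ler_pdivlMr// mul1r ltW.
by move=> /le_trans; apply; rewrite lerDl mulr_ge0.
Qed.

(** A positive probability of never returning would be a lower bound of the right
    side of [stay_le] for every [n]. For large [M] the term in [W] accounts for at
    most half of it, so the other half would come from the mean holding times,
    whose sum over [n] is finite. *)
Let never_null : P x (never x) = 0%E.
Proof.
set p := P x (never x).
have pfin : p \is a fin_num by apply: fin_num_measure; exact: measurable_never.
apply/eqP; rewrite eq_le measure_ge0 andbT leNgt; apply/negP => p0.
pose r := fine p; have r0 : 0 < r by rewrite fine_gt0// p0 ltey_eq pfin.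
have w0 := w_ge0.
(* Then the term of [stay_le] in [W] is at most half of [r]. *)
pose M := 2 * (w + 1) / r; have M0 : 0 < M by rewrite divr_gt0// mulr_gt0// ltr_wpDl.
have [K hK] := W_level M.
pose K' := Num.max K 0.
have K'0 : 0 <= K' by rewrite le_max lexx orbT.
have hK' z : W z <= M -> exit_rate q z <= K'.
  by move=> /hK zK; rewrite le_max zK.
have pn n : (0 < n)%N -> (r%:E <= (M^-1 * w)%:E + K'%:E * mean_after n ihold)%E.
  case: n => // n _; rewrite /r fineK//.
  apply: le_trans (le_trans (stay_le n.+1 M0 K'0 hK') _).
    apply: le_measure; rewrite ?inE; [exact: measurable_never|exact: (measurable_stay law)|].
    by move=> u; apply.
  by rewrite leeD2r// EFinM lee_wpmul2l// lee_fin invr_ge0 ltW.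
have sumN N : N%:R * r <= N%:R * (M^-1 * w) + K' * w.
  rewrite -lee_fin EFinD [X in (_ + X)%E]EFinM.
  apply: (@le_trans _ _ (\sum_(1 <= n < N.+1) ((M^-1 * w)%:E + K'%:E * mean_after n ihold))%E).
    apply: (@le_trans _ _ (\sum_(1 <= n < N.+1) r%:E)%E).
      by rewrite sumEFin big_const_nat subn1 iter_addr addr0 mulr_natl.
    rewrite big_nat_cond [leRHS]big_nat_cond; apply: lee_sum => n.
    by rewrite andbT => /andP[n0 _]; exact: pn.
  rewrite big_split/= -ge0_sume_distrr; last by move=> n _; exact: mean_after_ge0.
  rewrite sumEFin big_const_nat subn1 iter_addr addr0 mulr_natl leeD2l//.
  by rewrite lee_wpmul2l.
have Mw : M^-1 * w <= r / 2.
  rewrite mulrC ler_pdivrMr// (_ : r / 2 * M = w + 1) ?lerDl//.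
  by rewrite /M; field; rewrite gt_eqF.
pose N := Num.bound (2 * (K' * w) / r).
have : 2 * (K' * w) / r < N%:R by apply: archi_boundP; rewrite divr_ge0 ?mulr_ge0// ltW.
rewrite ltr_pdivrMr// => Nr.
have N0 : 0 <= N%:R :> R by [].
have := sumN N; have := ler_wpM2l N0 Mw; lra.
Qed.

Let first_jump_null : P x (Y 1%N @^-1` [set x]) = 0%E.
Proof.
have := tabooS law q_ge0 rate_gt0 predT x 0 x; rewrite /taboo /=.
rewrite (_ : stay Y predT 1 = setT); last by apply/seteqP; split.
rewrite setTI => ->; rewrite esum1// => z _.
have := taboo0 law predT x z; rewrite /taboo => ->.
have [->|zx] := eqVneq z x; last by rewrite mule0.
by rewrite /jump_prob gt_eqF// eqxx mul0e.
Qed.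

Let hold_before_return n := (T n \_ (stay Y B n))%E.

Let mean_hold_before_return n :
  (\int[P x]_v hold_before_return n v <= 2%:E * mean_after n ihold)%E.
Proof.
rewrite -integral_mkcond (@ge0_integral_fibers _ _ _ _ _ (Y n)); first last.
- by move=> v _; exact: T_ge0.
- by apply: measurable_funTS; exact: (measurable_hold law).
- by move=> z; exact: (measurable_taboo law).
rewrite /mean_after -ge0_esumZl//; last by move=> z; rewrite mule_ge0// lee_fin.
by apply: le_esum => z _; exact: hold_integral.
Qed.

Let sum_mean_ihold : (\sum_(n <oo) 2%:E * mean_after n ihold < +oo)%E.
Proof.
rewrite nneseriesZl//; last by move=> n _; exact: mean_after_ge0.
have start : mean_after 0 ihold = (ihold x)%:E.
  by rewrite /mean_after (taboo_start_sum (g := EFin \o ihold))//= lee_fin.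
suff h : (\sum_(n <oo) mean_after n ihold <= (ihold x + w)%:E)%E.
  apply: (@le_lt_trans _ _ (2%:E * (ihold x + w)%:E)%E); last exact: ltry.
  exact: lee_wpmul2l.
apply: lime_le; first by apply: is_cvg_nneseries => n _ _; exact: mean_after_ge0.
apply: nearW => -[|N].
  by rewrite big_geq// lee_fin addr_ge0.
change ((\sum_(0 <= n < N.+1) mean_after n ihold <= (ihold x + w)%:E)%E).
by rewrite big_ltn// start EFinD leeD2l.
Qed.

(** The return time is at most the sum of the holding times before the return,
    except when the chain never returns or when its first jump is to [x]: both
    are null events. *)
Lemma mean_return_time_fin : (\int[P x]_v return_time X x v < +oo)%E.
Proof.
pose Z := never x `|` Y 1%N @^-1` [set x].
have mY : measurable (Y 1%N @^-1` [set x]) by exact: (measurable_state law).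
have mZ : measurable Z by apply: measurableU => //; exact: measurable_never.
have PZ : P x Z = 0%E.
  apply/eqP; rewrite eq_le measure_ge0 andbT.
  apply: (le_trans (measureU2 _ (measurable_never x) mY)).
  by rewrite [X in (X + _)%E]never_null [X in (_ + X)%E]first_jump_null adde0.
have hb0 n v : (0 <= hold_before_return n v)%E.
  by apply: erestrict_ge0 => u _; exact: T_ge0.
pose G v := (\sum_(n <oo) hold_before_return n v)%E.
have G0 v : (0 <= G v)%E by apply: nneseries_ge0 => n _ _; exact: hb0.
have mhb n : measurable_fun setT (hold_before_return n).
  apply/(measurable_restrictT _ _).1; first exact: (measurable_stay law).
  by apply: measurable_funTS; exact: (measurable_hold law).
have le_G v : (return_time X x v <= G v + ((cst +oo%E) \_ Z) v)%E.
  rewrite patchE; case: ifPn => [_|].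
    by rewrite addey ?leey// gt_eqF// (lt_le_trans _ (G0 v)).
  rewrite adde0 notin_setE => /not_orP[nnever Y1].
  have [s [s0 Ys smin]] : exists s, [/\ (0 < s)%N, Y s v = x &
      forall i, (0 < i < s)%N -> Y i v != x].
    have ex : exists s, (0 < s)%N && (Y s v == x).
      apply: contrapT => h; apply: nnever => n _ i /andP[i0 _]; apply/negP => Yi.
      by apply: h; exists i; rewrite i0.
    case: (ex_minnP ex) => s /andP[s0 /eqP Ys] smin; exists s; split=> // i /andP[i0 si].
    apply/negP => Yi; have := smin i; rewrite i0 Yi => /(_ isT).
    by rewrite leqNgt si.
  have Gs : (jump_time s v <= G v)%E.
    apply: le_trans (nneseries_lim_ge s _) => //.
    rewrite big_mkord; apply: lee_sum => i _; rewrite /hold_before_return patchE.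
    rewrite ifT// inE => j /andP[j0 ji]; apply: smin.
    by rewrite j0 (leq_ltn_trans ji).
  apply: le_trans Gs.
  have [->|sfin] := eqVneq (jump_time s v) +oo%E; first exact: leey.
  have {}sfin : jump_time s v \is a fin_num.
    by rewrite ge0_fin_numE ?jump_time_ge0// lt_neqAle sfin leey.
  have s1 : (1 <= s)%N by [].
  have fin1 : jump_time 1 v \is a fin_num.
    rewrite ge0_fin_numE ?jump_time_ge0//.
    by rewrite (le_lt_trans (jump_time_le v s1))// ltey_eq sfin.
  rewrite -[leRHS]fineK//; apply: ereal_inf_lbound; exists (fine (jump_time s v)) => //.
  split; first by rewrite state_at_jump// Ys.
  exists (fine (jump_time 1 v)).
    rewrite fine_ge0 ?jump_time_ge0//= fine_le//; exact: jump_time_le.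
  by rewrite state_at_jump// => -[].
apply: (@le_lt_trans _ _ (\int[P x]_v (G v + ((cst +oo%E) \_ Z) v))%E).
  by apply: le_integral_sup => // v; exact: return_time_ge0.
rewrite ge0_integralD//; last 3 first.
- exact: ge0_emeasurable_sum.
- by move=> v _; apply: erestrict_ge0 => u _; exact: leey.
- by apply/(measurable_restrictT _ _).1.
rewrite -integral_mkcond integral_cst// [X in (+oo * X)%E]PZ mule0 adde0 /G integral_nneseries//.
apply: le_lt_trans sum_mean_ihold; apply: lee_nneseries => [n _ _|n _].
  by apply: integral_ge0.
exact: mean_hold_before_return.
Qed.

End drift.

End minimal_process_paths.

(** * Drift of functions of the tandem network *)

Lemma sum_le_prefix (R : realType) (a : nat -> R) N :
  (forall n, (N <= n)%N -> a n <= 0) ->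
  forall n, \sum_(j < n) a j <= \sum_(j < N) `|a j|.
Proof.
move=> aN n; pose S n := \sum_(j < n) `|a j|.
have SS k : S k.+1 = S k + `|a k| by rewrite /S big_ord_recr.
have Smono i j : (i <= j)%N -> S i <= S j.
  move=> /subnK <-; elim: (j - i)%N => // k IH.
  by rewrite addSn SS (le_trans IH)// lerDl.
apply: le_trans (Smono _ _ (geq_minr n N)).
elim: n => [|n IH]; first by rewrite min0n /S !big_ord0.
rewrite big_ord_recr/=; case: (ltnP n N) => nN.
  rewrite (minn_idPl nN) SS lerD ?ler_norm//.
  by rewrite (minn_idPl (ltnW nN)) in IH.
rewrite (minn_idPr (leqW nN)); rewrite (minn_idPr nN) in IH.
by have := aN n nN; lra.
Qed.

Section tandem_potentials.
Context {R : realType}.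
Variables (lambda : nat -> R) (mu1 mu2 : R).
Hypothesis lambda_ge0 : forall n, 0 <= lambda n.
Hypothesis lambda0_gt0 : 0 < lambda 0%N.
Hypothesis mu1_gt0 : 0 < mu1.
Hypothesis mu2_gt0 : 0 < mu2.
Implicit Types (f g : nat * nat -> R) (x z : nat * nat).

Definition tandem_sum f x : R :=
  lambda x.2 * f (x.1.+1, x.2) + (1 <= x.1)%N%:R * mu1 * f (x.1.-1, x.2.+1) +
  (1 <= x.2)%N%:R * mu2 * f (x.1, x.2.-1).

Definition total_rate x : R :=
  lambda x.2 + (1 <= x.1)%N%:R * mu1 + (1 <= x.2)%N%:R * mu2.

Lemma total_rate_gt0 x : 0 < total_rate x.
Proof.
rewrite /total_rate; case: x => [[|a] [|b]] /=.
- by rewrite !mul0r !addr0.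
- by rewrite mul0r mul1r addr0 ltr_wpDl.
- by rewrite mul0r mul1r addr0 ltr_wpDl.
- by rewrite !mul1r ltr_wpDl// addr_ge0// ltW.
Qed.

Lemma tandem_sum_le f g x : (forall z, f z <= g z) -> tandem_sum f x <= tandem_sum g x.
Proof.
by move=> fg; rewrite /tandem_sum !lerD// ler_wpM2l// mulr_ge0// ltW.
Qed.

Lemma tandem_sum_ge0 f x : (forall z, 0 <= f z) -> 0 <= tandem_sum f x.
Proof.
by move=> f0; rewrite /tandem_sum !addr_ge0// !mulr_ge0// ltW.
Qed.

Lemma tandem_sum_affine (a b : R) f x :
  tandem_sum (fun z => a + b * f z) x = total_rate x * a + b * tandem_sum f x.
Proof. by rewrite /tandem_sum /total_rate; ring. Qed.

Lemma tandem_sumD f g x :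
  tandem_sum (fun z => f z + g z) x = tandem_sum f x + tandem_sum g x.
Proof. by rewrite /tandem_sum; ring. Qed.

Lemma tandem_sum_sum (F : nat -> nat * nat -> R) n x :
  tandem_sum (fun z => \sum_(i < n) F i z) x = \sum_(i < n) tandem_sum (F i) x.
Proof.
elim: n => [|n IH]; first by rewrite big_ord0 /tandem_sum !big_ord0; ring.
rewrite big_ord_recr/= -IH -tandem_sumD /tandem_sum !big_ord_recr/=; ring.
Qed.

Lemma tandem_rateE x y : tandem_rate lambda mu1 mu2 x y =
  (y == (x.1.+1, x.2))%:R * lambda x.2 +
  (y == (x.1.-1, x.2.+1))%:R * ((1 <= x.1)%N%:R * mu1) +
  (y == (x.1, x.2.-1))%:R * ((1 <= x.2)%N%:R * mu2).
Proof.
have AB : ((x.1.+1, x.2) == (x.1.-1, x.2.+1)) = false.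
  by rewrite xpair_eqE [X in _ && X]ltn_eqF// andbF.
have AC : ((x.1.+1, x.2) == (x.1, x.2.-1)) = false.
  by rewrite xpair_eqE gtn_eqF.
have BC : ((x.1.-1, x.2.+1) == (x.1, x.2.-1)) = false.
  by rewrite xpair_eqE [X in _ && X]gtn_eqF ?andbF// ltnS leq_pred.
rewrite /tandem_rate; have [->|_] := eqVneq y; first by rewrite AB AC /=; ring.
have [->|_] := eqVneq y; first by rewrite BC andbT andbF; case: (1 <= x.1)%N => /=; ring.
have [_|_] := eqVneq y; last by rewrite !andbF /=; ring.
by rewrite andbF andbT; case: (1 <= x.2)%N => /=; ring.
Qed.

Lemma tandem_rate_diag x : tandem_rate lambda mu1 mu2 x x = 0.
Proof.
rewrite tandem_rateE; case: x => [a b]; rewrite !xpair_eqE /= ltn_eqF//= mul0r add0r.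
rewrite [b == b.+1]ltn_eqF// andbF mul0r add0r eqxx /=.
by case: b => [|b]/=; rewrite ?mul0r ?mulr0// gtn_eqF// mul0r.
Qed.

Lemma tandem_rate_ge0 x y : 0 <= tandem_rate lambda mu1 mu2 x y.
Proof.
rewrite /tandem_rate; case: ifP => // _; case: ifP => _; first exact: ltW.
by case: ifP => // _; exact: ltW.
Qed.

Lemma esum_tandem_rate f x : (forall z, 0 <= f z) ->
  (\esum_(y in setT) (tandem_rate lambda mu1 mu2 x y * f y)%:E =
   (tandem_sum f x)%:E)%E.
Proof.
move=> f0.
have pt (a : nat * nat) (c : R) : 0 <= c ->
    (\esum_(y in setT) ((y == a)%:R * c * f y)%:E = (c * f a)%:E)%E.
  move=> c0; rewrite (esumID [set a]); last first.
    by move=> y _; rewrite lee_fin !mulr_ge0.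
  rewrite [X in (_ + X)%E]esum1 ?adde0; last first.
    by move=> y [_ /= /eqP ya]; rewrite (negbTE ya) !mul0r.
  by rewrite setTI esum_set1 eqxx mul1r// lee_fin mulr_ge0.
have n1 : 0 <= (1 <= x.1)%N%:R * mu1 by rewrite mulr_ge0// ltW.
have n2 : 0 <= (1 <= x.2)%N%:R * mu2 by rewrite mulr_ge0// ltW.
rewrite /tandem_sum !EFinD -!pt//.
have nn (a y : nat * nat) (c : R) : 0 <= c -> (0 <= ((y == a)%:R * c * f y)%:E)%E.
  by move=> c0; rewrite lee_fin !mulr_ge0.
rewrite -!esumD//; try by move=> y _; rewrite ?adde_ge0 ?nn.
by apply: eq_esum => y _; rewrite tandem_rateE -!EFinD !mulrDl.
Qed.

(** * Potentials that are large drains on finitely many states *)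

(** The probability that the chain started from [z] visits [x] during its first
    [n] jumps. *)
Fixpoint hit_prob x n z : R :=
  if z == x then 1 else
  if n is m.+1 then tandem_sum (hit_prob x m) z / total_rate z else 0.

Lemma hit_prob_ge0 x n z : 0 <= hit_prob x n z.
Proof.
elim: n z => [|n IH] z /=; case: ifP => // _.
by rewrite divr_ge0 ?tandem_sum_ge0// ltW// total_rate_gt0.
Qed.

Lemma hit_prob_le1 x n z : hit_prob x n z <= 1.
Proof.
elim: n z => [|n IH] z /=; case: ifP => // _.
rewrite ler_pdivrMr ?total_rate_gt0// mul1r.
have := tandem_sum_le z IH; rewrite /tandem_sum /total_rate; lra.
Qed.

Lemma hit_prob_step x n z y : 0 < tandem_rate lambda mu1 mu2 z y ->
  0 < hit_prob x n y -> 0 < hit_prob x n.+1 z.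
Proof.
move=> zy hy /=; case: ifP => // _.
rewrite divr_gt0 ?total_rate_gt0//.
have h0 u : 0 <= hit_prob x n u by exact: hit_prob_ge0.
rewrite -lte_fin -esum_tandem_rate//.
apply: lt_le_trans (le_esum1 y _); first by rewrite lte_fin mulr_gt0.
by move=> u; rewrite lee_fin mulr_ge0// tandem_rate_ge0.
Qed.

Lemma hit_prob_path z s :
  path (fun a b => 0 < tandem_rate lambda mu1 mu2 a b) z s ->
  0 < hit_prob (last z s) (size s) z.
Proof.
elim: s z => [|y s IH] z /=; first by rewrite eqxx.
by move=> /andP[zy ys]; exact: (hit_prob_step zy (IH _ ys)).
Qed.

(** The potential is a multiple of the expected number of times [i < n] by which
    [x] has not been visited yet: at each jump this number decreases in the mean
    by the probability of a visit by time [n], which is positive at [z0]. *)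
Lemma drain_at x z0 (b : R) : (exists n, 0 < hit_prob x n z0) ->
  exists U, [/\ forall z, 0 <= U z,
    forall z, z != x -> tandem_sum U z <= total_rate z * U z &
    z0 != x -> tandem_sum U z0 + b <= total_rate z0 * U z0].
Proof.
move=> [n hn].
pose Phi z := \sum_(i < n) hit_prob x i z.
have PhiE z : z != x ->
    tandem_sum Phi z = total_rate z * (Phi z + hit_prob x n z).
  move=> zx; rewrite /Phi tandem_sum_sum.
  have -> : Phi z + hit_prob x n z = \sum_(i < n) hit_prob x i.+1 z.
    rewrite /Phi -(big_ord_recr n (fun i => hit_prob x i z)) big_ord_recl/=.
    by case: n {hn Phi} => [|n] /=; rewrite ?(negbTE zx) ?add0r// .
  rewrite mulr_sumr; apply: eq_bigr => i _ /=.
  by rewrite (negbTE zx) mulrC divfK// gt_eqF ?total_rate_gt0.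
pose c := `|b| / (total_rate z0 * hit_prob x n z0).
have d0 : 0 < total_rate z0 * hit_prob x n z0 by rewrite mulr_gt0 ?total_rate_gt0.
have c0 : 0 <= c by rewrite divr_ge0// ltW.
pose U z := c * n%:R + - c * Phi z.
have UE z : z != x ->
    tandem_sum U z = total_rate z * U z - c * (total_rate z * hit_prob x n z).
  by move=> zx; rewrite /U tandem_sum_affine PhiE//; ring.
exists U; split=> [z|z zx|z0x].
- rewrite /U mulNr -mulrBr mulr_ge0// subr_ge0 /Phi.
  rewrite -[X in _ <= X%:R]card_ord -sum1_card natr_sum ler_sum// => i _.
  exact: hit_prob_le1.
- rewrite UE// gerBl mulr_ge0// mulr_ge0 ?hit_prob_ge0// ltW//.
  exact: total_rate_gt0.
- rewrite UE// /c divfK ?gt_eqF//.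
  by rewrite -addrA gerDl addrC subr_le0 ler_norm.
Qed.

Lemma drain_on x (b : nat * nat -> R) (F : seq (nat * nat)) :
  (forall z, exists n, 0 < hit_prob x n z) ->
  exists U, [/\ forall z, 0 <= U z,
    forall z, z != x -> tandem_sum U z <= total_rate z * U z &
    forall z, z != x -> z \in F -> tandem_sum U z + b z <= total_rate z * U z].
Proof.
move=> hit; elim: F => [|z0 F [U [U0 Ux UF]]].
  by exists (fun=> 0); split=> // z _; rewrite /tandem_sum; lra.
have [U' [U'0 U'x U'F]] := drain_at (b z0) (hit z0).
exists (fun z => U z + U' z); split=> [z|z zx|z zx].
- by rewrite addr_ge0.
- by rewrite tandem_sumD mulrDr lerD ?Ux ?U'x.
- rewrite tandem_sumD mulrDr in_cons => /predU1P[zz0|zF].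
    by rewrite zz0 in zx *; rewrite -addrA lerD ?Ux ?U'F.
  by rewrite addrAC lerD ?UF ?U'x.
Qed.

(** * The potential of the stable case *)

(** The drift of [z.1 + f z.2], written with [H = 1 - f'] so that the boundary
    [z.2 = 0] is no exception: there the absent departure would contribute
    [mu2 * (H 0 - 1) = 0]. *)
Lemma linear_drift (f H : nat -> R) (C : R) x :
  (forall n, f n.+1 = f n + (1 - H n.+1)) -> H 0%N = 1 ->
  let V z := z.1%:R + f z.2 + C in
  tandem_sum V x = total_rate x * V x +
    (lambda x.2 - (0 < x.1)%N%:R * mu1 * H x.2.+1 + mu2 * (H x.2 - 1)).
Proof.
move=> fS H0 V; rewrite /V /tandem_sum /total_rate.
case: x => [[|a] [|b]] /=; rewrite !fS -?[in _.+2%:R]natr1 -?[in _.+1%:R]natr1.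
all: rewrite ?H0; ring.
Qed.

Section stable.
Variable eps : R.

(** The value at [n] stands for one minus the increment of the potential from
    [n.-1] to [n]; the recurrence says that the drift is exactly [- eps] where the
    first queue is not empty. *)
Fixpoint stable_deficit n : R :=
  if n is m.+1 then (lambda m + eps - mu2 + mu2 * stable_deficit m) / mu1 else 1.

Let H := stable_deficit.
Let f n : R := \sum_(j < n) (1 - H j.+1).

Let HE n : mu1 * H n.+1 = lambda n + eps - mu2 + mu2 * H n.
Proof. by rewrite /H /= mulrC divfK// gt_eqF. Qed.

(** [mu2 * (mu1 / mu2) ^+ n] is the integrating factor of the recurrence that
    defines the deficits. *)
Lemma stable_deficitE n : mu2 * (mu1 / mu2) ^+ n * stable_deficit n =
  mu2 + \sum_(j < n) (mu1 / mu2) ^+ j * (lambda j + eps - mu2).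
Proof.
elim: n => [|n IH]; first by rewrite big_ord0 expr0 !mulr1 addr0.
rewrite big_ord_recr/= addrA -IH exprS -/H.
rewrite (_ : mu2 * _ * _ = (mu1 / mu2) ^+ n * (lambda n + eps - mu2 + mu2 * H n)).
  by ring.
by rewrite /H/=; field; rewrite !gt_eqF.
Qed.

Lemma stable_drift (C : R) x :
  let V z := z.1%:R + f z.2 + C in
  tandem_sum V x + eps = total_rate x * V x + (x.1 == 0)%N%:R * mu1 * H x.2.+1.
Proof.
move=> V; rewrite (@linear_drift f H)//; last by move=> n; rewrite /f big_ord_recr.
have -> : (0 < x.1)%N%:R = 1 - (x.1 == 0)%N%:R :> R.
  by case: (x.1) => [|a] /=; rewrite ?subrr ?subr0.
rewrite /V; have := HE x.2; lra.
Qed.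

(** The increments [1 - H n] of the potential are eventually at least 1, so it grows at
    least like the second coordinate up to a constant, which is added to it. *)
Lemma stable_potential :
  (exists N, forall n, (N <= n)%N -> H n.+1 <= 0) ->
  exists (V : nat * nat -> R) N, [/\ forall z, z.2%:R <= V z &
    forall z, ~~ ((z.1 == 0)%N && (z.2 < N)%N) ->
      tandem_sum V z + eps <= total_rate z * V z].
Proof.
move=> [N HN].
have fE n : f n = n%:R - \sum_(j < n) H j.+1.
  by rewrite /f sumrB sumr_const card_ord.
exists (fun z => z.1%:R + f z.2 + \sum_(j < N) `|H j.+1|), N; split=> [z|z zF].
  rewrite fE; have := sum_le_prefix (a := fun j => H j.+1) HN z.2.
  by have : 0 <= z.1%:R :> R by []; lra.
rewrite stable_drift gerDl.
move: zF; case: eqP => _ /=; last by rewrite !mul0r.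
rewrite -leqNgt mul1r => /HN; exact: mulr_ge0_le0 (ltW mu1_gt0).
Qed.

End stable.

(** * The potential of the unstable case *)

Section unstable.
Variable eps : R.
Hypothesis eps_gt0 : 0 < eps.
Variable N : nat.
Hypothesis lambda_large : forall n, (N <= n)%N -> mu2 + 2 * eps <= lambda n.
Hypothesis le_mu21 : mu2 <= mu1.

(** Truncating the arrival rates keeps the second order error bounded in
    [inverse_superharmonic]. *)
Let lam n := Num.min (lambda n) (mu2 + 2 * eps).

(** The largest deficits at most 1/2 for which, with the arrival rates [lam], the
    drift is at least [eps] where the first queue is not empty. *)
Fixpoint unstable_deficit n : R :=
  if n is m.+1 then Num.min (1 / 2) ((lam m - eps - mu2 + mu2 * unstable_deficit m) / mu1)
  else 1.
Arguments unstable_deficit : simpl never.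

Let H := unstable_deficit.
Let f n : R := \sum_(j < n) (1 - H j.+1).
Let V z : R := z.1%:R + f z.2.

Let HS n : H n.+1 = Num.min (1 / 2) ((lam n - eps - mu2 + mu2 * H n) / mu1).
Proof. by []. Qed.

Let H_le_half n : H n.+1 <= 1 / 2.
Proof. by rewrite HS ge_min lexx. Qed.

Let H_le n : mu1 * H n.+1 <= lam n - eps - mu2 + mu2 * H n.
Proof. by rewrite mulrC -ler_pdivlMr// HS ge_min lexx orbT. Qed.

Let lamE n : (N <= n)%N -> lam n = mu2 + 2 * eps.
Proof. by move=> /lambda_large/min_idPr. Qed.

Let H_persists n : (N <= n)%N -> 0 <= H n -> 0 <= H n.+1.
Proof.
move=> Nn Hn; rewrite HS lamE// le_min divr_ge0//= divr_ge0 ?(ltW mu1_gt0)//.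
by have := mulr_ge0 (ltW mu2_gt0) Hn; have := eps_gt0; lra.
Qed.

(** Above [N] a negative deficit increases by at least [eps / mu1] at each step,
    because [mu2 <= mu1]. *)
Let H_eventually_ge0 : exists M, forall n, (M <= n)%N -> 0 <= H n.
Proof.
have [M [NM HM]] : exists M, (N <= M)%N /\ 0 <= H M.
  apply: contrapT => /forallNP h.
  have Hneg n : (N <= n)%N -> H n < 0.
    by move=> Nn; rewrite ltNge; apply/negP => Hn; apply: (h n).
  have grow k : H N + k%:R * (eps / mu1) <= H (k + N)%N.
    elim: k => [|k IH]; first by rewrite mul0r addr0.
    have kN : (N <= k + N)%N by rewrite leq_addl.
    have neg := Hneg _ kN; have := Hneg _ (leqW kN).
    rewrite addSn HS lamE// minElt; case: ifP => _; first by move=> ?; lra.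
    move=> _; rewrite -natr1 mulrDl mul1r addrA.
    apply: le_trans (lerD IH (lexx _)) _.
    rewrite ler_pdivlMr// mulrDl divfK ?gt_eqF//.
    have : (mu1 - mu2) * H (k + N)%N <= 0 by rewrite mulr_ge0_le0 ?subr_ge0// ltW.
    lra.
  pose K := Num.bound (`|H N| / (eps / mu1)).
  have e0 : 0 < eps / mu1 by rewrite divr_gt0.
  have : `|H N| / (eps / mu1) < K%:R by rewrite archi_boundP// divr_ge0// ltW.
  rewrite ltr_pdivrMr// => hK.
  have := grow K; have := Hneg (K + N)%N (leq_addl _ _); have := ler_norm (- H N).
  by rewrite normrN; lra.
exists M => n /subnK <-; elim: (n - M)%N => // k IH.
by rewrite addSn H_persists// (leq_trans NM)// leq_addl.
Qed.

Let H_bounded : exists2 D : R, 0 < D & forall n, `|H n| + 1 <= D.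
Proof.
have [M HM] := H_eventually_ge0.
exists (2 + \sum_(j < M) `|H j|).
  by rewrite ltr_wpDr// sumr_ge0.
have s0 : 0 <= \sum_(j < M) `|H j| by rewrite sumr_ge0.
move=> n; case: (leqP M n) => [Mn|nM].
  rewrite ger0_norm ?HM//.
  have : H n <= 1 by case: n {Mn} => [//|n]; have := H_le_half n; lra.
  lra.
rewrite (bigD1 (Ordinal nM))//=.
have : 0 <= \sum_(i < M | i != Ordinal nM) `|H i| by rewrite sumr_ge0.
lra.
Qed.

Let fS n : f n.+1 = f n + (1 - H n.+1).
Proof. by rewrite /f big_ord_recr. Qed.

Let f_mono m n : (m <= n)%N -> f m <= f n.
Proof.
move=> /subnK <-; elim: (n - m)%N => // k IH.
by rewrite addSn fS (le_trans IH)// lerDl; have := H_le_half (k + m); lra.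
Qed.

Let f_ge0 n : 0 <= f n.
Proof. by have := f_mono (leq0n n); rewrite {1}/f big_ord0. Qed.

Let inv_expansion (u dl k D : R) : 0 < k -> `|dl| <= D -> k + D <= u ->
  (u + dl)^-1 <= u^-1 + (- dl + D ^+ 2 / k) / u ^+ 2.
Proof.
move=> k0 dlD kDu; have D0 : 0 <= D by exact: le_trans dlD.
have u0 : 0 < u by rewrite (lt_le_trans _ kDu)// ltr_wpDr.
move: (dlD); rewrite ler_norml => /andP[Ddl dl_D].
have udl : k <= u + dl by lra.
have udl0 : 0 < u + dl by exact: lt_le_trans udl.
have -> : (u + dl)^-1 = u^-1 + (- dl + dl ^+ 2 / (u + dl)) / u ^+ 2.
  by field; rewrite !gt_eqF.
rewrite lerD2l ler_wpM2r ?invr_ge0 ?exprn_ge0 ?(ltW u0)// lerD2l.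
apply: ler_pM; rewrite ?sqr_ge0 ?invr_ge0 ?(ltW udl0)//.
  by rewrite -(real_normK (num_real dl)) lerXn2r ?nnegrE.
by rewrite lef_pV2 ?posrE.
Qed.

(** [1 / (c + V)] is superharmonic off finitely many states: its increments are
    those of [- V], of mean at most [- eps], divided by [(c + V) ^ 2], up to a
    second order error which is small when [c] is large. Arrivals beyond the rate
    [mu2 + 2 eps] only help, whatever their rate. *)
Let inverse_superharmonic : exists c M, 0 < c /\ forall z,
  ~~ ((z.1 == 0)%N && (z.2 < M)%N) ->
  tandem_sum (fun y => (c + V y)^-1) z <= total_rate z * (c + V z)^-1.
Proof.
have [M HM] := H_eventually_ge0; have [D D0 HD] := H_bounded.
have e0 := eps_gt0; have m10 := mu1_gt0; have m20 := mu2_gt0.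
pose L := (mu2 + 2 * eps) + mu1 + mu2.
have L0 : 0 < L by rewrite /L; lra.
(* With this [k] the second order errors, of total rate at most [L], cost at
   most [eps]. *)
pose k := L * D ^+ 2 / eps.
have k0 : 0 < k by rewrite divr_gt0// mulr_gt0// exprn_gt0.
pose kap := D ^+ 2 / k.
have kapE : L * kap = eps.
  by rewrite /kap /k; field; rewrite !gt_eqF.
have kap0 : 0 <= kap by rewrite divr_ge0 ?sqr_ge0// ltW.
exists (k + D), M; split; first by rewrite addr_gt0.
move=> z zF; set u := k + D + V z.
have V0 y : 0 <= V y by rewrite addr_ge0.
have ku : k + D <= u by rewrite /u lerDl.
have u0 : 0 < u by rewrite (lt_le_trans _ ku)// addr_gt0.
have D1 : 1 <= D by have := HD 0%N; have := normr_ge0 (H 0%N); lra.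
have u2 : 0 < u ^+ 2 by rewrite exprn_gt0.
have arr : lambda z.2 * (k + D + V (z.1.+1, z.2))^-1 <=
    lambda z.2 * u^-1 + lam z.2 * (- 1 + kap) / u ^+ 2.
  have -> : k + D + V (z.1.+1, z.2) = u + 1 by rewrite /u /V/= -natr1; ring.
  have i1 : (u + 1)^-1 <= u^-1 + (- 1 + kap) / u ^+ 2.
    by apply: inv_expansion; rewrite ?normr1.
  have i2 : (u + 1)^-1 <= u^-1.
    by rewrite lef_pV2 ?lerDl ?posrE ?ler01 ?(addr_gt0 u0) ?u0.
  have lam_le : lam z.2 <= lambda z.2 by rewrite ge_min lexx.
  have lam0 : 0 <= lam z.2 by rewrite le_min lambda_ge0/=; lra.
  have := ler_wpM2l lam0 i1.
  have : (lambda z.2 - lam z.2) * ((u + 1)^-1 - u^-1) <= 0.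
    by rewrite mulr_ge0_le0 ?subr_ge0// subr_le0.
  lra.
have srv1 : (1 <= z.1)%N%:R * mu1 * (k + D + V (z.1.-1, z.2.+1))^-1 <=
    (1 <= z.1)%N%:R * mu1 * u^-1 +
    (1 <= z.1)%N%:R * mu1 * (H z.2.+1 + kap) / u ^+ 2.
  case E : z.1 => [|a]; first by rewrite !mul0r addr0.
  rewrite !mul1r -mulrA -mulrDr ler_wpM2l ?(ltW m10)//=.
  have -> : k + D + V (a, z.2.+1) = u + - H z.2.+1.
    by rewrite /u /V/= E fS -[a.+1%:R]natr1; ring.
  have := @inv_expansion u (- H z.2.+1) k D k0; rewrite opprK; apply=> //.
  by rewrite normrN; have := HD z.2.+1; lra.
have srv2 : (1 <= z.2)%N%:R * mu2 * (k + D + V (z.1, z.2.-1))^-1 <=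
    (1 <= z.2)%N%:R * mu2 * u^-1 + mu2 * (1 - H z.2 + (1 <= z.2)%N%:R * kap) / u ^+ 2.
  case E : z.2 => [|b].
    by rewrite !mul0r addr0 (_ : H 0%N = 1)// subrr mulr0 mul0r addr0.
  rewrite !mul1r -mulrA -mulrDr ler_wpM2l ?(ltW m20)//=.
  have -> : k + D + V (z.1, b) = u + (H b.+1 - 1).
    by rewrite /u /V/= E fS; ring.
  have := @inv_expansion u (H b.+1 - 1) k D k0; rewrite opprB; apply=> //.
  by rewrite (le_trans (ler_normB _ _))// normr1.
set G := lam z.2 * (- 1 + kap) + (1 <= z.1)%N%:R * mu1 * (H z.2.+1 + kap) +
  mu2 * (1 - H z.2 + (1 <= z.2)%N%:R * kap).
suff G0 : G / u ^+ 2 <= 0.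
  rewrite /tandem_sum /total_rate; move: G0; rewrite /G !mulrDl; lra.
rewrite mulr_le0_ge0 ?invr_ge0 ?(ltW u2)//.
have b2 : (1 <= z.2)%N%:R * (mu2 * kap) <= mu2 * kap.
  apply: ler_piMl; first by rewrite mulr_ge0 ?(ltW m20).
  by case: (1 <= z.2)%N; rewrite /= ?lexx ?ler01.
have lk : lam z.2 * kap <= (mu2 + 2 * eps) * kap.
  by rewrite ler_wpM2r// ge_min lexx orbT.
have mk : 0 <= mu1 * kap by rewrite mulr_ge0// ltW.
have hl := H_le z.2.
move: kapE; rewrite /L => kapE; rewrite /G.
move: zF; case: (z.1) => [|a] /= zF.
  have h0 : 0 <= mu1 * H z.2.+1.
    by rewrite mulr_ge0 ?(ltW m10)// HM// leqW// leqNgt.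
  lra.
lra.
Qed.

(** With [m] a bound of [c + V] on the exceptional states, the maximum of 0 and
    [1 - m / (c + V)] vanishes there, and elsewhere it is a maximum of two
    subharmonic functions. *)
Lemma unstable_potential : exists (v : nat * nat -> R) k, [/\
  forall z, 0 <= v z <= 1, v (0, 0)%N = 0, 0 < v (k, 0)%N &
  forall z, total_rate z * v z <= tandem_sum v z].
Proof.
have [c [M [c0 sup]]] := inverse_superharmonic.
have V0 y : 0 <= V y by rewrite addr_ge0.
have cV y : 0 < c + V y by rewrite ltr_wpDr.
pose m := c + f M.
have m0 : 0 < m by rewrite ltr_wpDr.
pose v z := Num.max 0 (1 + - m * (c + V z)^-1).
have v_ge z : 1 + - m * (c + V z)^-1 <= v z by rewrite le_max lexx orbT.
have v0 z : 0 <= v z by rewrite le_max lexx.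
have f0 : f 0%N = 0 by rewrite /f big_ord0.
exists v, (Num.bound (f M)); split.
- move=> z; rewrite v0/= ge_max ler01/= gerDl mulNr oppr_le0.
  by rewrite mulr_ge0 ?invr_ge0 ?ltW.
- apply/max_idPl; rewrite mulNr subr_le0 ler_pdivlMr// mul1r /V/= f0.
  by rewrite addr0 /m lerD2l f_ge0.
- rewrite lt_max; apply/orP; right.
  rewrite mulNr subr_gt0 ltr_pdivrMr// mul1r /V/= f0 addr0 /m ltrD2l.
  by apply: archi_boundP; exact: f_ge0.
move=> z; have [v_le0|v_gt0] := leP (1 + - m * (c + V z)^-1) 0.
  have -> : v z = 0 by apply/max_idPl.
  by rewrite mulr0 tandem_sum_ge0.
have -> : v z = 1 + - m * (c + V z)^-1 by apply/max_idPr/ltW.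
apply: (le_trans _ (tandem_sum_le z v_ge)).
rewrite tandem_sum_affine.
have zF : ~~ ((z.1 == 0)%N && (z.2 < M)%N).
  apply/negP => /andP[/eqP z1 z2]; move: v_gt0; rewrite ltNge => /negP; apply.
  rewrite mulNr subr_le0 ler_pdivlMr// mul1r /V z1 add0r /m lerD2l.
  exact/f_mono/ltnW.
have := ler_wpM2l (ltW m0) (sup z zF); lra.
Qed.

End unstable.
End tandem_potentials.

(** * Stability criteria for the tandem network *)

Section tandem_process.
Context {R : realType}.
Variables (lambda : nat -> R) (mu1 mu2 : R).
Hypothesis lambda_ge0 : forall n, 0 <= lambda n.
Hypothesis lambda0_gt0 : 0 < lambda 0%N.
Hypothesis mu1_gt0 : 0 < mu1.
Hypothesis mu2_gt0 : 0 < mu2.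
Let q := tandem_rate lambda mu1 mu2.
Let rate := total_rate lambda mu1 mu2.
Let sum_next := tandem_sum lambda mu1 mu2.
Implicit Types (x y z : nat * nat) (f : nat * nat -> R).

Let q_ge0 x y : 0 <= q x y. Proof. exact: tandem_rate_ge0. Qed.
Let rate_gt0 x : 0 < rate x. Proof. exact: total_rate_gt0. Qed.

Lemma tandem_exit_rate x : exit_rate q x = rate x.
Proof.
rewrite /exit_rate esum_mkcond (eq_esum (b := fun y => (q x y * 1)%:E)).
  rewrite esum_tandem_rate//= /rate /total_rate /tandem_sum; ring.
move=> y _; rewrite mulr1; case: ifPn => //; rewrite notin_setE/= => /negP.
by rewrite negbK => /eqP ->; rewrite /q tandem_rate_diag.
Qed.

Lemma tandem_jump_prob x y : jump_prob q x y = (rate x)^-1 * q x y.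
Proof.
rewrite /jump_prob tandem_exit_rate gt_eqF//; case: eqP => [<-|_].
  by rewrite /q tandem_rate_diag mulr0.
by rewrite mulrC.
Qed.

Lemma esum_tandem_jump f x : (forall z, 0 <= f z) ->
  (\esum_(y in setT) (jump_prob q x y * f y)%:E = (sum_next f x / rate x)%:E)%E.
Proof.
move=> f0; rewrite mulrC EFinM /sum_next -esum_tandem_rate//.
rewrite -ge0_esumZl ?invr_ge0 ?ltW//.
  by apply: eq_esum => y _; rewrite tandem_jump_prob -mulrA EFinM.
by move=> y; rewrite lee_fin mulr_ge0 ?q_ge0.
Qed.

(** * Irreducibility *)

Let connected x y := exists2 s, path (fun a b => 0 < q a b) x s & last x s = y.

Let connected_step x y : 0 < q x y -> connected x y.
Proof. by move=> xy; exists [:: y] => //=; rewrite xy. Qed.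

Let connected_trans x y z : connected x y -> connected y z -> connected x z.
Proof.
move=> [s xs sy] [t yt tz]; exists (s ++ t); rewrite ?cat_path ?last_cat ?sy//.
by rewrite xs.
Qed.

Let arrival n : 0 < q (n, 0)%N (n.+1, 0)%N.
Proof. by rewrite /q /tandem_rate eqxx. Qed.

Let transfer a b : 0 < q (a.+1, b) (a, b.+1).
Proof.
by rewrite /q /tandem_rate /= !xpair_eqE !eqxx (ltn_eqF (leqnSn a.+1)).
Qed.

Let departure a b : 0 < q (a, b.+1) (a, b).
Proof.
rewrite /q /tandem_rate /= !xpair_eqE !eqxx (ltn_eqF (leqnn a.+1)).
by rewrite (ltn_eqF (leqnSn b.+1)) !andbF.
Qed.

Let empty_second a b : connected (a, b) (a, 0)%N.
Proof.
elim: b => [|b IH]; first by exists [::].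
exact: connected_trans (connected_step (departure a b)) IH.
Qed.

Let empty_first a : connected (a, 0)%N (0, 0)%N.
Proof.
elim: a => [|a IH]; first by exists [::].
apply: connected_trans IH.
exact: connected_trans (connected_step (transfer a 0)) (empty_second a 1).
Qed.

Let fill_first n : connected (0, 0)%N (n, 0)%N.
Proof.
elim: n => [|n IH]; first by exists [::].
exact: connected_trans IH (connected_step (arrival n)).
Qed.

Let fill_second n m : connected (n + m, 0)%N (n, m).
Proof.
elim: m n => [|m IH] n; first by rewrite addn0; exists [::].
rewrite addnS -addSn.
exact: connected_trans (IH n.+1) (connected_step (transfer n m)).
Qed.

(** Empty the second queue, then the first one, customer by customer; from the
    origin, where arrivals are possible because [lambda 0 > 0], let enough
    customers arrive while the second queue stays empty, then move the required
    number of them. *)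
Lemma tandem_connected x y : connected x y.
Proof.
case: x y => [a b] [n m].
apply: connected_trans (empty_second a b) _.
apply: connected_trans (empty_first a) _.
exact: connected_trans (fill_first (n + m)) (fill_second n m).
Qed.

Context {d : measure_display} {Omega : measurableType d}.
Variables (P : nat * nat -> probability Omega R).
Variable X : R -> Omega -> option (nat * nat).
Hypothesis X_min : minimal_process q P X.

Let exit_gt0 x : 0 < exit_rate q x.
Proof. by rewrite tandem_exit_rate. Qed.

Let jump_gt0 x y : 0 < q x y -> 0 < jump_prob q x y.
Proof. by move=> xy; rewrite tandem_jump_prob mulr_gt0 ?invr_gt0. Qed.

Lemma tandem_irreducible : irreducible_process P X.
Proof.
have [Y [T [law XE]]] := X_min.
apply: (irreducible_criterion law exit_gt0 XE) => x y.
have [s xs <-] := tandem_connected x y; exists (size s + 0)%N.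
apply: (taboo_path law q_ge0 exit_gt0); last by rewrite all_predT.
  by rewrite (taboo0 law) eqxx.
by apply: sub_path xs => a b /jump_gt0.
Qed.

(** The drift of [V] on the exceptional states, whatever it is, is compensated
    by a potential from [drain_on]. *)
Lemma tandem_ergodic (eps : R) : 0 < eps ->
  (exists N, forall n, (N <= n)%N -> stable_deficit lambda mu1 mu2 eps n.+1 <= 0) ->
  ergodic P X.
Proof.
move=> eps0 slope; split; first exact: tandem_irreducible.
have [Y [T [law XE]]] := X_min.
move=> x.
have [V [N [V_ge V_drift]]] := stable_potential mu1_gt0 slope.
pose b z := sum_next V z + eps - rate z * V z.
have hit z : exists n, 0 < hit_prob lambda mu1 mu2 x n z.
  have [s zs <-] := tandem_connected z x; exists (size s).
  exact: hit_prob_path.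
have [U [U0 Ux UF]] := drain_on lambda_ge0 lambda0_gt0 mu1_gt0 mu2_gt0 b
  [seq (0, j)%N | j <- iota 0 N] hit.
pose W z := 0 + eps^-1 * (V z + U z).
have V0 z : 0 <= V z by apply: le_trans (V_ge z).
have W0 z : 0 <= W z by rewrite /W add0r mulr_ge0 ?addr_ge0// invr_ge0 ltW.
have W_drift z : z != x -> sum_next W z + 1 <= rate z * W z.
  move=> zx; rewrite /sum_next tandem_sum_affine mulr0 add0r tandem_sumD.
  have -> : 1 = eps^-1 * eps by rewrite mulVf// gt_eqF.
  rewrite /W add0r -mulrDr mulrCA ler_wpM2l ?invr_ge0 ?(ltW eps0)// mulrDr.
  have [zF|zF] := boolP (z \in [seq (0, j)%N | j <- iota 0 N]).
    have := UF z zx zF; rewrite /b /sum_next /rate; lra.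
  apply: (@le_trans _ _ (sum_next V z + eps + sum_next U z)).
    by rewrite /sum_next; lra.
  rewrite lerD ?Ux// V_drift//; apply: contraNN zF => /andP[/eqP z1 z2].
  apply/mapP; exists z.2; rewrite ?mem_iota// -z1.
  by case: (z).
have ie z : exit_rate q z = rate z by exact: tandem_exit_rate.
apply: (mean_return_time_fin law q_ge0 exit_gt0 XE W0) => [z zx||M].
- rewrite esum_tandem_jump// ie -EFinD lee_fin -[X in _ + X]mul1r -mulrDl.
  by rewrite ler_pdivrMr// mulrC W_drift.
- by rewrite esum_tandem_jump// ltry.
have [k Mk] : exists k, eps * M <= k%:R.
  exists (Num.bound `|eps * M|); apply: le_trans (ler_norm _) (ltW _).
  exact: archi_boundP.
exists (\sum_(j < k.+1) lambda j + mu1 + mu2) => z WM; rewrite ie /rate /total_rate.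
have zk : (z.2 < k.+1)%N.
  rewrite ltnS -(ler_nat R) (le_trans _ Mk)//.
  apply: (@le_trans _ _ (V z + U z)); first by rewrite (le_trans (V_ge z))// lerDl.
  by rewrite -ler_pdivrMl// -[leLHS]add0r.
rewrite !lerD//; last 2 first.
- by case: (1 <= z.1)%N; rewrite ?mul1r// mul0r ltW.
- by case: (1 <= z.2)%N; rewrite ?mul1r// mul0r ltW.
by rewrite (bigD1 (Ordinal zk))//= lerDl sumr_ge0.
Qed.

(** From the origin the chain reaches [(k, 0)] by [k] arrivals, hence without
    returning. *)
Lemma tandem_not_ergodic (eps : R) N : 0 < eps -> mu2 <= mu1 ->
  (forall n, (N <= n)%N -> mu2 + 2 * eps <= lambda n) -> ~ ergodic P X.
Proof.
move=> eps0 le_mu21 lambda_large [_].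
have [Y [T [law XE]]] := X_min.
have [v [k [v01 v00 vk sub]]] := unstable_potential lambda_ge0 mu1_gt0 mu2_gt0
  eps0 lambda_large le_mu21.
have v0 z : 0 <= v z by case/andP: (v01 z).
apply: (not_positive_recurrent_criterion law q_ge0 exit_gt0 XE v01 v00 vk (m := k)).
  elim: k {vk} => [|k IH]; first by rewrite (taboo0 law) eqxx.
  exact: (taboo_step law q_ge0 exit_gt0 IH (jump_gt0 (arrival k))).
move=> z; rewrite esum_tandem_jump// lee_fin ler_pdivlMr// mulrC.
exact: sub.
Qed.

End tandem_process.

(** * Averages of the arrival rate *)

Lemma limn_esup_lt (R : realType) (u : nat -> \bar R) (c : R) :
  (forall n, -oo < u n)%E -> (limn_esup u < c%:E)%E ->
  exists2 r, r < c & exists N, forall n, (N <= n)%N -> (u n <= r%:E)%E.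
Proof.
move=> u_gt; rewrite /limn_esup /limf_esup => /ereal_inf_lt[_ [A [N _ NA] <-]] Ac.
set s := ereal_sup _ in Ac.
have us n : (N <= n)%N -> (u n <= s)%E.
  by move=> Nn; apply: ereal_sup_ubound; exists n => //; exact: NA.
have sfin : s \is a fin_num.
  rewrite fin_numE; apply/andP; split.
    by rewrite gt_eqF// (lt_le_trans (u_gt N) (us N (leqnn N))).
  by rewrite lt_eqF// (lt_trans Ac)// ltry.
exists (fine s); first by rewrite -lte_fin fineK.
by exists N => n Nn; rewrite fineK// us.
Qed.

Lemma ge_natr_geometric (R : realType) (rho : R) n : 1 <= rho ->
  n%:R <= \sum_(j < n) rho ^+ j.
Proof.
move=> rho1; rewrite -[X in X%:R <= _]card_ord -sum1_card natr_sum ler_sum//.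
by move=> i _; rewrite exprn_ege1.
Qed.

(** When the geometric averages of [lambda] are at most [r < mu2], the quantity
    of [stable_deficitE] is at most [mu2 - eps * n] with [eps] half the gap
    [mu2 - r]. *)
Lemma weighted_average_deficit (R : realType) (lambda : nat -> R) (mu1 mu2 r : R) :
  0 < mu2 -> mu2 <= mu1 -> r < mu2 ->
  (exists N, forall n, (N <= n)%N ->
     \sum_(j < n.+1) (mu1 / mu2) ^+ j * lambda j <=
     r * \sum_(j < n.+1) (mu1 / mu2) ^+ j) ->
  exists N, forall n, (N <= n)%N ->
    stable_deficit lambda mu1 mu2 ((mu2 - r) / 2) n.+1 <= 0.
Proof.
move=> mu2_gt0 le_mu21 r_lt [N HN].
have mu1_gt0 : 0 < mu1 by rewrite (lt_le_trans mu2_gt0).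
set rho := mu1 / mu2 in HN *; set eps := (mu2 - r) / 2.
have eps0 : 0 < eps by rewrite divr_gt0// subr_gt0.
have rho1 : 1 <= rho by rewrite ler_pdivlMr// mul1r.
have k0 : 0 <= mu2 / eps by rewrite divr_ge0 ?ltW.
exists (maxn N (Num.bound (mu2 / eps))) => n; rewrite geq_max => /andP[Nn kn].
have pos : 0 < mu2 * rho ^+ n.+1.
  by rewrite mulr_gt0// exprn_gt0// (lt_le_trans ltr01).
rewrite -(pmulr_rle0 _ pos) stable_deficitE// -/rho.
set G := \sum_(j < n.+1) rho ^+ j in HN.
rewrite (_ : \sum_(j < n.+1) _ =
    \sum_(j < n.+1) rho ^+ j * lambda j + (eps - mu2) * G); last first.
  rewrite /G mulr_sumr -big_split/=; apply: eq_bigr => j _; ring.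
have Geps : mu2 <= eps * G.
  rewrite mulrC -ler_pdivrMr// (le_trans (ltW (archi_boundP k0)))//.
  by rewrite (le_trans _ (ge_natr_geometric n.+1 rho1))// ler_nat leqW.
have := HN n Nn; rewrite -/G.
have -> : r = mu2 - 2 * eps by rewrite /eps; field.
lra.
Qed.

(** Averages with weights of infinite sum forget the first terms; the bound
    loses half of the gap between [r] and [c]. *)
Lemma eventually_le_weighted (R : realType) (lambda : nat -> R) (rho r c : R) :
  1 <= rho -> r < c -> (exists N, forall n, (N <= n)%N -> lambda n <= r) ->
  exists N, forall n, (N <= n)%N ->
    \sum_(j < n.+1) rho ^+ j * lambda j <=
    (r + c) / 2 * \sum_(j < n.+1) rho ^+ j.
Proof.
move=> rho1 rc [J HJ].
pose a j := rho ^+ j * (lambda j - r).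
have aJ n : (J <= n)%N -> a n <= 0.
  move=> /HJ lr; rewrite mulr_ge0_le0 ?subr_le0// exprn_ge0//.
  exact: le_trans rho1.
set C := \sum_(j < J) `|a j|; set e := (c - r) / 2.
have e0 : 0 < e by rewrite divr_gt0// subr_gt0.
have C0 : 0 <= C / e by rewrite divr_ge0 ?sumr_ge0// ltW.
exists (Num.bound (C / e)) => n kn.
set G := \sum_(j < n.+1) rho ^+ j.
have -> : \sum_(j < n.+1) rho ^+ j * lambda j = \sum_(j < n.+1) a j + r * G.
  rewrite /G mulr_sumr -big_split/=; apply: eq_bigr => j _; rewrite /a; ring.
have CG : C <= e * G.
  rewrite mulrC -ler_pdivrMr// (le_trans (ltW (archi_boundP C0)))//.
  by rewrite (le_trans _ (ge_natr_geometric n.+1 rho1))// ler_nat leqW.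
have := sum_le_prefix aJ n.+1; rewrite -/C.
have -> : (r + c) / 2 = r + e by rewrite /e; field.
lra.
Qed.

Lemma expectation_geom_ge (R : realType) (d : measure_display)
    (Omega : measurableType d) (P : probability Omega R) (Z : {RV P >-> nat})
    (lambda : nat -> R) n z : (forall n, 0 <= lambda n) -> 0 <= z ->
  geom_law P n z Z ->
  (((\sum_(j < n.+1) z ^+ j * lambda j) / \sum_(j < n.+1) z ^+ j)%:E <=
   'E_P[fun w => lambda (Z w)])%E.
Proof.
move=> lambda_ge0 z0 law.
have mZ j : measurable ([set: Omega] `&` Z @^-1` [set j]).
  by apply: measurable_funP.
have mf : measurable_fun [set: Omega] (fun w => (lambda (Z w))%:E).
  by apply/measurable_EFinP; apply: measurableT_comp.
have -> : ('E_P[fun w => lambda (Z w)] =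
    \esum_(j in setT) \int[P]_(w in [set: Omega] `&` Z @^-1` [set j]) (lambda (Z w))%:E)%E.
  by rewrite unlock; apply: ge0_integral_fibers => // w _; rewrite lee_fin.
have E j : (\int[P]_(w in [set: Omega] `&` Z @^-1` [set j]) (lambda (Z w))%:E =
    (lambda j)%:E * P (Z @^-1` [set j]))%E.
  rewrite setTI -integral_cst; last by rewrite -[X in measurable X]setTI.
  by apply: eq_integral => w; rewrite inE/= => ->.
under eq_esum do rewrite E.
rewrite -nneseries_esumT; last by move=> j; rewrite mule_ge0// lee_fin.
apply: le_trans (nneseries_lim_ge n.+1 _); last by move=> j _ _; rewrite mule_ge0// lee_fin.
rewrite big_mkord mulr_suml -sumEFin; apply: lee_sum => j _.
rewrite law -ltnS ltn_ord -EFinM lee_fin; lra.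
Qed.


Theorem theorem4 (R : realType) (lambda : nat -> R) (mu1 mu2 : R)
    (lambda_ge0 : forall n, 0 <= lambda n) (lambda0_gt0 : 0 < lambda 0%N)
    (mu1_gt0 : 0 < mu1) (mu2_gt0 : 0 < mu2) (le_mu21 : mu2 <= mu1)
    (dZ : nat -> measure_display) (OmegaZ : forall n, measurableType (dZ n))
    (PZ : forall n, probability (OmegaZ n) R)
    (Z : forall n, {RV (PZ n) >-> nat})
    (Z_geom : forall n, geom_law (PZ n) n (mu1 / mu2) (Z n))
    (d : measure_display) (Omega : measurableType d)
    (P : nat * nat -> probability Omega R)
    (X : R -> Omega -> option (nat * nat))
    (X_min : minimal_process (tandem_rate lambda mu1 mu2) P X) :
  [/\ (limn_esup (fun n => 'E_(PZ n)[fun w => lambda (Z n w)]) < mu2%:E)%E ->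
        ergodic P X,
      (mu2%:E < limn_einf (fun n => (lambda n)%:E))%E -> ~ ergodic P X &
      forall l : \bar R, (lambda n)%:E @[n --> \oo] --> l ->
        ((l < mu2%:E)%E -> ergodic P X) /\ ((mu2%:E < l)%E -> ~ ergodic P X)].
Proof.
have rho1 : 1 <= mu1 / mu2 by rewrite ler_pdivlMr// mul1r.
have stable r : r < mu2 -> (exists N, forall n, (N <= n)%N ->
     \sum_(j < n.+1) (mu1 / mu2) ^+ j * lambda j <=
     r * \sum_(j < n.+1) (mu1 / mu2) ^+ j) -> ergodic P X.
  move=> rmu /(weighted_average_deficit mu2_gt0 le_mu21 rmu) slope.
  apply: (tandem_ergodic lambda_ge0 lambda0_gt0 mu1_gt0 mu2_gt0 X_min _ slope).
  by rewrite divr_gt0// subr_gt0.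
have unstable : (mu2%:E < limn_einf (fun n => (lambda n)%:E))%E -> ~ ergodic P X.
  rewrite /limn_einf lteNr -EFinN => /limn_esup_lt[n|r rmu [N HN]].
    by rewrite /= ltNyr.
  apply: (tandem_not_ergodic lambda_ge0 lambda0_gt0 mu1_gt0 mu2_gt0 X_min
    (eps := (- r - mu2) / 2) (N := N)) => // [|n Nn].
    by rewrite divr_gt0// subr_gt0 ltrNr.
  have := HN n Nn; rewrite /= lee_fin => ?; lra.
split=> // [Elt|l lambda_l].
  have E0 n : (0 <= 'E_(PZ n)[fun w => lambda (Z n w)])%E.
    by rewrite unlock; apply: integral_ge0 => w _; rewrite lee_fin.
  have [n|r rmu [N HN]] := limn_esup_lt _ Elt.
    by rewrite (lt_le_trans _ (E0 n))// ltNy0.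
  apply: (stable r rmu); exists N => n Nn.
  have z0 : 0 <= mu1 / mu2 by exact: le_trans rho1.
  have := le_trans (expectation_geom_ge lambda_ge0 z0 (Z_geom n)) (HN n Nn).
  rewrite lee_fin ler_pdivrMr//.
  by rewrite (lt_le_trans _ (ge_natr_geometric n.+1 rho1)).
have [einfE esupE] := cvg_limn_einf_sup lambda_l.
split=> [lmu|]; last by rewrite -einfE.
have [r rmu rN] : exists2 r, r < mu2 & exists N, forall n, (N <= n)%N ->
    ((lambda n)%:E <= r%:E)%E.
  by apply: limn_esup_lt; [move=> n; rewrite ltNyr|rewrite esupE].
apply: (stable ((r + mu2) / 2)); first lra.
exact: eventually_le_weighted.
Qed.
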